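(* Let $k$ be a field, let $a\ge 1$, $d\ge 1$ and $b\in\{1,2,3\}$ be integers, put $m_0=3a+b$, $m_i=m_0+id$ for $i=1,2,3$, and assume $\gcd(m_0,m_1,m_2,m_3)=1$. Let $R=k[x_0,x_1,x_2,y]$ with the standard grading, let $C\subset\mathbb{A}^4$ be the monomial curve $x_0=t^{m_0},\ x_1=t^{m_1},\ x_2=t^{m_2},\ y=t^{m_3}$, and let $G\cong R/I(C)^*$ be its associated graded ring at the origin. With the maps $\phi_i(b)$ given by the matrices listed in the context, the minimal graded free resolution of $G$ is: if $b=1$, $$0\to R(-(a+3))^3\xrightarrow{\phi_3(1)}R(-3)^2\oplus R(-(a+2))^6\xrightarrow{\phi_2(1)}R(-2)^3\oplus R(-(a+1))^3\xrightarrow{\phi_1(1)}R;$$ if $b=2$, $$0\to R(-(a+4))\xrightarrow{\phi_3(2)}R(-3)^2\oplus R(-(a+2))^3\xrightarrow{\phi_2(2)}R(-2)^3\oplus R(-(a+1))^2\xrightarrow{\phi_1(2)}R;$$ if $b=3$, $$0\to R(-(a+4))^2\xrightarrow{\phi_3(3)}R(-3)^2\oplus R(-(a+3))^3\xrightarrow{\phi_2(3)}R(-2)^3\oplus R(-(a+1))\xrightarrow{\phi_1(3)}R.$$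
   Context: $I(C)$ is the kernel of the $k$-algebra homomorphism $R=k[x_0,x_1,x_2,y]\to k[t]$, $x_0\mapsto t^{m_0}$, $x_1\mapsto t^{m_1}$, $x_2\mapsto t^{m_2}$, $y\mapsto t^{m_3}$. For a nonzero polynomial $f$, $f^*$ denotes its homogeneous summand of least degree, and $I(C)^*$ is the ideal generated by all $f^*$ with $0\ne f\in I(C)$. Let $A=k[[t^{m_0},t^{m_1},t^{m_2},t^{m_3}]]$ with maximal ideal $m=(t^{m_0},\dots,t^{m_3})$; $G=\mathrm{gr}_m(A)=\bigoplus_{i\ge0}m^i/m^{i+1}\cong R/I(C)^*$ as graded $R$-algebras. $R(-j)$ is the graded free module of rank one generated in degree $j$. Matrices act on column vectors; the basis elements of the free modules are ordered to match the matrices (the direct sums above only record the multiset of shifts, so the order of the summands may be permuted). Matrices for $b=1$: $$\phi_1(1)=\begin{pmatrix}x_1^2-x_0x_2& x_1x_2-x_0y& x_2^2-x_1y& x_1y^a& x_2y^a& y^{a+1}\end{pmatrix},$$ $$\phi_2(1)=\begin{pmatrix} x_2& y^a& -y&0&0&0&0&0\\ -x_1&0&x_2&y^a&0&0&0&0\\ x_0&0&-x_1&0&y^a&0&0&0\\ 0&-x_1&0&-x_2&0&x_2&y&0\\ 0&x_0&0&0&-x_2&-x_1&0&y\\ 0&0&0&x_0&x_1&0&-x_1&-x_2 \end{pmatrix},\qquad \phi_3(1)=\begin{pmatrix} y^a&0&0\\ -x_2&y&0\\ 0&y^a&0\\ x_1&-x_2&0\\ -x_0&x_1&0\\ 0&-x_2&y\\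 0&x_1&-x_2\\ 0&-x_0&x_1 \end{pmatrix}.$$ Matrices for $b=2$: $$\phi_1(2)=\begin{pmatrix}x_1^2-x_0x_2& x_1x_2-x_0y& x_2^2-x_1y& x_2y^a& y^{a+1}\end{pmatrix},$$ $$\phi_2(2)=\begin{pmatrix} x_2&-y&0&0&0\\ -x_1&x_2&y^a&0&0\\ x_0&-x_1&0&y^a&0\\ 0&0&-x_1&-x_2&y\\ 0&0&x_0&x_1&-x_2 \end{pmatrix},\qquad \phi_3(2)=\begin{pmatrix} y^{a+1}\\ x_2y^a\\ -x_2^2+x_1y\\ x_1x_2-x_0y\\ x_1^2-x_0x_2 \end{pmatrix}.$$ Matrices for $b=3$: $$\phi_1(3)=\begin{pmatrix}x_1^2-x_0x_2& x_1x_2-x_0y& x_2^2-x_1y& y^{a+1}\end{pmatrix},$$ $$\phi_2(3)=\begin{pmatrix} x_2&y^{a+1}&-y&0&0\\ -x_1&0&x_2&y^{a+1}&0\\ x_0&0&-x_1&0&y^{a+1}\\ 0&-x_1^2+x_0x_2&0&-x_1x_2+x_0y&-x_2^2+x_1y \end{pmatrix},\qquad \phi_3(3)=\begin{pmatrix} y^{a+1}&0\\ -x_2&y\\ 0&y^{a+1}\\ x_1&-x_2\\ -x_0&x_1 \end{pmatrix}.$$ *)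

(* Defs.v *)
From mathcomp Require Import all_boot all_order all_algebra.
From mathcomp.multinomials Require Import mpoly.

Set Implicit Arguments.
Unset Strict Implicit.
Unset Printing Implicit Defensive.

Import GRing.Theory.
Local Open Scope ring_scope.

Definition ideal_gen (T : comNzRingType) (S : T -> Prop) (f : T) : Prop :=
  exists (l : nat) (c g : 'I_l -> T),
    (forall j, S (g j)) /\ f = \sum_(j < l) c j * g j.

Definition param (k : fieldType) (m : 'I_4 -> nat) (f : {mpoly k[4]}) :
    {poly k} :=
  mmap (@polyC k) (fun i => 'X^(m i)) f.

Definition curve_ideal (k : fieldType) (m : 'I_4 -> nat) (f : {mpoly k[4]}) :
    Prop :=
  param m f = 0.

Definition init_deg (k : fieldType) (f : {mpoly k[4]}) : nat :=
  find (fun d => pihomog mdeg d f != 0) (iota 0 (msize f)).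

(* f^*; the value at f = 0 is 0 and is never used. *)
Definition init_form (k : fieldType) (f : {mpoly k[4]}) : {mpoly k[4]} :=
  pihomog mdeg (init_deg f) f.

Definition tangent_ideal (k : fieldType) (m : 'I_4 -> nat) :
    {mpoly k[4]} -> Prop :=
  ideal_gen (fun g => exists f, [/\ f != 0, curve_ideal m f & g = init_form f]).

(* Elements of k[[t]] are coefficient sequences, compared by =1. *)
Definition series (k : fieldType) := nat -> k.

Definition smul (k : fieldType) (s u : series k) : series k :=
  fun n => \sum_(i < n.+1) s i * u (n - i)%N.

Definition stpow (k : fieldType) (e : nat) : series k := fun n => (n == e)%:R.

(* Finite sums of products p * q with p in P and q in Q. *)
Definition sprod (k : fieldType) (P Q : series k -> Prop) (s : series k) :
    Prop :=
  exists (l : nat) (p q : 'I_l -> series k),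
    [/\ forall j, P (p j), forall j, Q (q j)
      & s =1 (fun n => \sum_(j < l) smul (p j) (q j) n)].

(* s = F(t^(m 0), ..., t^(m 3)) for a formal power series F = sum_e F_e X^e.
   When every m i is positive, an exponent e with sum_i e_i m_i = n has total
   degree at most n, so the bounded sum runs over all such e. *)
Definition in_A (k : fieldType) (m : 'I_4 -> nat) (s : series k) : Prop :=
  exists F : 'X_{1..4} -> k, forall n,
    s n = \sum_(e : 'X_{1..4 < n.+1} | (\sum_(i < 4) e i * m i == n)%N) F e.

Definition max_ideal (k : fieldType) (m : 'I_4 -> nat) : series k -> Prop :=
  sprod (in_A m) (fun s => exists i, s =1 stpow k (m i)).

Fixpoint max_pow (k : fieldType) (m : 'I_4 -> nat) (i : nat) :
    series k -> Prop :=
  if i is j.+1 then sprod (max_pow m j) (max_ideal m) else in_A m.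

Definition param_series (k : fieldType) (m : 'I_4 -> nat) (f : {mpoly k[4]}) :
    series k :=
  fun n => (param m f)`_n.

(* The graded k-algebra map R -> gr_m(A) = (+)_i m^i/m^(i+1), x_i |-> the class
   of t^(m i) in m/m^2, sends f in R_i to the class of f(t^m) in m^i/m^(i+1).
   It is well defined, surjective in every degree, and its kernel is J; that is,
   it induces a graded isomorphism R/J = gr_m(A). *)
Definition presents_gr (k : fieldType) (m : 'I_4 -> nat)
    (J : {mpoly k[4]} -> Prop) : Prop :=
  [/\ forall i (f : {mpoly k[4]}), f \is i.-homog ->
        max_pow m i (param_series m f),
      forall i (s : series k), max_pow m i s ->
        exists2 f : {mpoly k[4]}, f \is i.-homog &
          max_pow m i.+1 (fun n => s n - param_series m f n)
    & forall f : {mpoly k[4]},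
        J f <-> forall i, max_pow m i.+1 (param_series m (pihomog mdeg i f))].

(* v is homogeneous of degree s in (+)_j R(-d_j). *)
Definition homog_vec (k : fieldType) (n : nat) (d : n.-tuple nat) (s : nat)
    (v : 'cV[{mpoly k[4]}]_n) : Prop :=
  forall j, if (tnth d j <= s)%N then v j 0 \is (s - tnth d j).-homog
            else v j 0 == 0.

Definition graded_map (k : fieldType) (p n : nat) (e : p.-tuple nat)
    (d : n.-tuple nat) (phi : 'M[{mpoly k[4]}]_(p, n)) : Prop :=
  forall s v, homog_vec d s v -> homog_vec e s (phi *m v).

Definition irrelevant_ideal (k : fieldType) : {mpoly k[4]} -> Prop :=
  ideal_gen (fun g => exists i : 'I_4, g = 'X_i).

Definition minimal_map (k : fieldType) (p n : nat)
    (phi : 'M[{mpoly k[4]}]_(p, n)) : Prop :=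
  forall (v : 'cV_n) i, irrelevant_ideal ((phi *m v) i 0).

Definition exact_at (k : fieldType) (p n q : nat)
    (phi : 'M[{mpoly k[4]}]_(p, n)) (psi : 'M[{mpoly k[4]}]_(n, q)) : Prop :=
  forall v : 'cV_n, phi *m v = 0 <-> exists w : 'cV_q, v = psi *m w.

(* 0 -> (+)R(-d3_j) -> (+)R(-d2_j) -> (+)R(-d1_j) -> R is a minimal graded free
   resolution of the graded module R/J, the augmentation being R -> R/J. *)
Definition minimal_graded_free_resolution (k : fieldType) (n1 n2 n3 : nat)
    (J : {mpoly k[4]} -> Prop)
    (d1 : n1.-tuple nat) (d2 : n2.-tuple nat) (d3 : n3.-tuple nat)
    (phi1 : 'M[{mpoly k[4]}]_(1, n1)) (phi2 : 'M[{mpoly k[4]}]_(n1, n2))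
    (phi3 : 'M[{mpoly k[4]}]_(n2, n3)) : Prop :=
  [/\ [/\ graded_map [tuple 0%N] d1 phi1, graded_map d1 d2 phi2
        & graded_map d2 d3 phi3],
      [/\ forall f, J f <-> exists v : 'cV_n1, (phi1 *m v) 0 0 = f,
          exact_at phi1 phi2, exact_at phi2 phi3
        & forall v : 'cV_n3, phi3 *m v = 0 -> v = 0]
    & [/\ minimal_map phi1, minimal_map phi2 & minimal_map phi3]].

Definition mx_of_rows (T : Type) (p n : nat) (r : p.-tuple (n.-tuple T)) :
    'M[T]_(p, n) :=
  \matrix_(i < p, j < n) tnth (tnth r i) j.

Section Matrices.
Variables (k : fieldType) (a : nat).

Let x0 : {mpoly k[4]} := 'X_(@Ordinal 4 0 isT).
Let x1 : {mpoly k[4]} := 'X_(@Ordinal 4 1 isT).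
Let x2 : {mpoly k[4]} := 'X_(@Ordinal 4 2 isT).
Let y : {mpoly k[4]} := 'X_(@Ordinal 4 3 isT).

Definition phi1_1 : 'M[{mpoly k[4]}]_(1, 6) := mx_of_rows [tuple
  [tuple x1 ^+ 2 - x0 * x2; x1 * x2 - x0 * y; x2 ^+ 2 - x1 * y;
         x1 * y ^+ a; x2 * y ^+ a; y ^+ a.+1]].

Definition phi2_1 : 'M[{mpoly k[4]}]_(6, 8) := mx_of_rows [tuple
  [tuple x2;   y ^+ a; - y;  0;      0;      0;    0;    0];
  [tuple - x1; 0;      x2;   y ^+ a; 0;      0;    0;    0];
  [tuple x0;   0;      - x1; 0;      y ^+ a; 0;    0;    0];
  [tuple 0;    - x1;   0;    - x2;   0;      x2;   y;    0];
  [tuple 0;    x0;     0;    0;      - x2;   - x1; 0;    y];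
  [tuple 0;    0;      0;    x0;     x1;     0;    - x1; - x2]].

Definition phi3_1 : 'M[{mpoly k[4]}]_(8, 3) := mx_of_rows [tuple
  [tuple y ^+ a; 0;      0];
  [tuple - x2;   y;      0];
  [tuple 0;      y ^+ a; 0];
  [tuple x1;     - x2;   0];
  [tuple - x0;   x1;     0];
  [tuple 0;      - x2;   y];
  [tuple 0;      x1;     - x2];
  [tuple 0;      - x0;   x1]].

Definition phi1_2 : 'M[{mpoly k[4]}]_(1, 5) := mx_of_rows [tuple
  [tuple x1 ^+ 2 - x0 * x2; x1 * x2 - x0 * y; x2 ^+ 2 - x1 * y;
         x2 * y ^+ a; y ^+ a.+1]].

Definition phi2_2 : 'M[{mpoly k[4]}]_(5, 5) := mx_of_rows [tuple
  [tuple x2;   - y;  0;      0;      0];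
  [tuple - x1; x2;   y ^+ a; 0;      0];
  [tuple x0;   - x1; 0;      y ^+ a; 0];
  [tuple 0;    0;    - x1;   - x2;   y];
  [tuple 0;    0;    x0;     x1;     - x2]].

Definition phi3_2 : 'M[{mpoly k[4]}]_(5, 1) := mx_of_rows [tuple
  [tuple y ^+ a.+1];
  [tuple x2 * y ^+ a];
  [tuple - x2 ^+ 2 + x1 * y];
  [tuple x1 * x2 - x0 * y];
  [tuple x1 ^+ 2 - x0 * x2]].

Definition phi1_3 : 'M[{mpoly k[4]}]_(1, 4) := mx_of_rows [tuple
  [tuple x1 ^+ 2 - x0 * x2; x1 * x2 - x0 * y; x2 ^+ 2 - x1 * y; y ^+ a.+1]].

Definition phi2_3 : 'M[{mpoly k[4]}]_(4, 5) := mx_of_rows [tuple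
  [tuple x2;   y ^+ a.+1;           - y;  0;                   0];
  [tuple - x1; 0;                   x2;   y ^+ a.+1;           0];
  [tuple x0;   0;                   - x1; 0;                   y ^+ a.+1];
  [tuple 0;    - x1 ^+ 2 + x0 * x2; 0;    - (x1 * x2) + x0 * y;
                                                  - x2 ^+ 2 + x1 * y]].

Definition phi3_3 : 'M[{mpoly k[4]}]_(5, 2) := mx_of_rows [tuple
  [tuple y ^+ a.+1; 0];
  [tuple - x2;      y];
  [tuple 0;         y ^+ a.+1];
  [tuple x1;        - x2];
  [tuple - x0;      x1]].

End Matrices.

(* Main.v *)
Require Import Defs.
From mathcomp Require Import all_boot all_order all_algebra.
From mathcomp.multinomials Require Import mpoly.
From mathcomp Require Import ring zify.

(** Put M = 3a+b, so that m_i = M + i d and gcd(M, d) = 1. Write q1, q2, q3 for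
the quadrics x1^2 - x0 x2, x1 x2 - x0 y, x2^2 - x1 y, which generate the ideal P
of the cone over the twisted cubic.

The graded ring. The powers of the maximal ideal of A are monomial: a series lies
in m^i exactly when each of its exponents is the weight of a monomial of degree
at least i ([max_pow_supp]). Hence a form f of degree s maps to zero in
m^s/m^(s+1) iff each term of f(t^m) can be rewritten as a monomial of larger
degree, that is iff f is zero or the initial form of an element of I(C)
([tangent_presents_gr]).

The tangent cone. A monomial of degree s and cubic degree c = e1 + 2 e2 + 3 e3 has
weight s M + c d, and monomials that agree in s and c are congruent modulo P,
since both straighten to the same x0^i x_j y^l with j <= 2. If c >= M, the
straightened monomial is divisible by y^(a+1) or by some x_j y^a with b <= j <= 2,
each of which is the initial form of its difference with a monomial of higher
degree. If c < M, coprimality of M and d shows that no other (s', c') with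
s' >= s gives the same weight; so in an initial form of degree s the coefficients
of the monomials with a given c < M add up to a coefficient of f(t^m) = 0
([tangent_sub]). Therefore I(C)^* is generated by P together with y^(a+1), x2 y^a if b <= 2, and x1 y^a if b = 1, which
are the entries of phi_1.

Exactness. The quadrics q1 and q3 are coprime, y is regular modulo P, and the
relations on x2, y and on x1, x2, y are the Koszul ones ([cubic_regular]); the
rest is linear algebra over a domain. The first fact gives the Hilbert-Burch theorem
for P ([cubic_syzygies]). A relation among the entries of phi_1 is then peeled
off: the cofactor of y^a lies in P by regularity, which leaves a Koszul relation
and a syzygy of the quadrics. The kernels of phi_2 and phi_3 follow by
elimination. The first two facts hold because (q3) and P are kernels of monomial
maps into domains ([q3_kernel], [cubic_kernel]).

Minimality and homogeneity are read off the entries ([entries_graded_minimal]). *)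

Set Implicit Arguments.
Unset Strict Implicit.
Unset Printing Implicit Defensive.

Import GRing.Theory.
Local Open Scope ring_scope.

(** * Syzygies of the twisted cubic and of its extensions by powers of y *)

(** Reduces an equality to a ring identity that writes the difference of its sides
as a combination of known equations. *)
Lemma linear_combination1 (R : pzRingType) (c l r a b : R) :
  l = r -> a - b = c * (l - r) -> a = b.
Proof. by move=> -> E; apply/eqP; rewrite -subr_eq0 E subrr mulr0. Qed.

Lemma linear_combination2 (R : pzRingType) (c c' l r l' r' a b : R) :
  l = r -> l' = r' -> a - b = c * (l - r) + c' * (l' - r') -> a = b.
Proof.
by move=> -> -> E; apply/eqP; rewrite -subr_eq0 E !subrr !mulr0 addr0.
Qed.

Section CubicSyzygies.
Variables (R : idomainType) (x0 x1 x2 y : R).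

Let q1 := x1 ^+ 2 - x0 * x2.
Let q2 := x1 * x2 - x0 * y.
Let q3 := x2 ^+ 2 - x1 * y.

(** The 2 x 2 minors of the matrix with rows (x0, x1, x2) and (x1, x2, y): the ideal
of the cone over the twisted cubic. *)
Definition cubic_ideal (f : R) : Prop :=
  exists u1 u2 u3, f = u1 * q1 + u2 * q2 + u3 * q3.

(** The regularity facts from which all three complexes are shown exact by linear
algebra over a domain. *)
Record cubic_regular : Prop := CubicRegular {
  cubic_y_neq0 : y != 0;
  cubic_q1_neq0 : q1 != 0;
  cubic_q3_neq0 : q3 != 0;
  cubic_q13_coprime : forall f g, q1 * f = q3 * g -> exists h, f = q3 * h;
  cubic_y_regular : forall n f, cubic_ideal (y ^+ n * f) -> cubic_ideal f;
  cubic_koszul2 : forall f g, x2 * f + y * g = 0 ->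
    exists h, f = y * h /\ g = - (x2 * h);
  cubic_koszul3 : forall f g h, x1 * f + x2 * g + y * h = 0 ->
    exists r s t, [/\ f = x2 * r + y * s, g = - (x1 * r) + y * t
                    & h = - (x1 * s) - x2 * t] }.

Hypothesis reg : cubic_regular.

Lemma coprime_quotient f g : q1 * f = q3 * g ->
  exists h, f = q3 * h /\ g = q1 * h.
Proof.
move=> E; have [h Ef] := cubic_q13_coprime reg E.
exists h; split=> //; apply: (mulfI (cubic_q3_neq0 reg)).
by apply: (linear_combination2 (c := -1) (c' := q1) E Ef); ring.
Qed.

(** Hilbert-Burch: if u = M w for the 3 x 2 matrix M of relations, Cramer's rule on
the first two rows of M computes q3 w from u, and on the last two rows q1 w. For
any syzygy u these two expressions are proportional, so coprimality of q1 and q3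
allows w to be divided out. *)
Lemma cubic_syzygies u1 u2 u3 : q1 * u1 + q2 * u2 + q3 * u3 = 0 ->
  exists w1 w2, [/\ u1 = x2 * w1 - y * w2, u2 = - (x1 * w1) + x2 * w2
                  & u3 = x0 * w1 - x1 * w2].
Proof.
move=> E; have nz1 := cubic_q1_neq0 reg; have nz3 := cubic_q3_neq0 reg.
have [|w1 [E1 F1]] := @coprime_quotient (x2 * u1 + y * u2) (- x1 * u2 - x2 * u3).
  by apply: (linear_combination1 (c := x2) E); rewrite /q1 /q2 /q3; ring.
have [|w2 [E2 F2]] := @coprime_quotient (x1 * u1 + x2 * u2) (- x0 * u2 - x1 * u3).
  by apply: (linear_combination1 (c := x1) E); rewrite /q1 /q2 /q3; ring.
exists w1, w2; split.
- apply: (mulfI nz3); apply: (linear_combination2 (c := x2) (c' := - y) E1 E2).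
  by rewrite /q1 /q2 /q3; ring.
- apply: (mulfI nz3); apply: (linear_combination2 (c := - x1) (c' := x2) E1 E2).
  by rewrite /q1 /q2 /q3; ring.
- apply: (mulfI nz1); apply: (linear_combination2 (c := x0) (c' := - x1) F1 F2).
  by rewrite /q1 /q2 /q3; ring.
Qed.

Variable a : nat.
Let z := y ^+ a.

(** The complex for b = 3 is the tensor product of the Hilbert-Burch complex with the
Koszul complex on y^(a+1). As y^(a+1) is regular modulo the cubic ideal, v4 lies
in that ideal; subtracting Koszul columns leaves a syzygy of the quadrics. *)
Lemma kernel_phi1_3 v1 v2 v3 v4 : q1 * v1 + q2 * v2 + q3 * v3 + y * z * v4 = 0 ->
  exists w1 w2 w3 w4 w5,
  [/\ v1 = x2 * w1 + y * z * w2 - y * w3,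
      v2 = - (x1 * w1) + x2 * w3 + y * z * w4,
      v3 = x0 * w1 - x1 * w3 + y * z * w5
    & v4 = - (q1 * w2) - q2 * w4 - q3 * w5].
Proof.
move=> E.
have [|c1 [c2 [c3 Ec]]] := @cubic_y_regular reg a.+1 v4.
  exists (- v1), (- v2), (- v3).
  by apply: (linear_combination1 (c := 1) E); rewrite exprS -/z; ring.
have [|w1 [w3 [E1 E2 E3]]] :=
    @cubic_syzygies (v1 + y * z * c1) (v2 + y * z * c2) (v3 + y * z * c3).
  by apply: (linear_combination2 (c := 1) (c' := - y * z) E Ec); ring.
exists w1, (- c1), w3, (- c2), (- c3); split.
- by apply: (linear_combination1 (c := 1) E1); ring.
- by apply: (linear_combination1 (c := 1) E2); ring.
- by apply: (linear_combination1 (c := 1) E3); ring.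
- by rewrite Ec; ring.
Qed.

(** The minor of M on its first two rows is q3, which is not zero. *)
Lemma cubic_syzygies_injective w1 w2 :
  x2 * w1 - y * w2 = 0 -> - (x1 * w1) + x2 * w2 = 0 -> w1 = 0 /\ w2 = 0.
Proof.
move=> E1 E2; have nz3 := cubic_q3_neq0 reg; split; apply: (mulfI nz3).
- by apply: (linear_combination2 (c := x2) (c' := y) E1 E2); rewrite /q3; ring.
- by apply: (linear_combination2 (c := x1) (c' := x2) E1 E2); rewrite /q3; ring.
Qed.

(** The last row makes (v2, v4, v5) a syzygy of the quadrics, hence an M s. The first
three rows become M (v1 + y^(a+1) s1, v3 + y^(a+1) s2) = 0, and M is injective. *)
Lemma kernel_phi2_3 v1 v2 v3 v4 v5 :
    x2 * v1 + y * z * v2 - y * v3 = 0 ->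
    - (x1 * v1) + x2 * v3 + y * z * v4 = 0 ->
    x0 * v1 - x1 * v3 + y * z * v5 = 0 ->
    - (q1 * v2) - q2 * v4 - q3 * v5 = 0 ->
  exists w1 w2,
  [/\ v1 = y * z * w1, v2 = - (x2 * w1) + y * w2, v3 = y * z * w2,
      v4 = x1 * w1 - x2 * w2 & v5 = - (x0 * w1) + x1 * w2].
Proof.
move=> E1 E2 E3 E4.
have [|s1 [s2 [F2 F4 F5]]] := @cubic_syzygies v2 v4 v5.
  by apply: (linear_combination1 (c := -1) E4); ring.
have [||G1 G2] := @cubic_syzygies_injective (v1 + y * z * s1) (v3 + y * z * s2).
- by apply: (linear_combination2 (c := 1) (c' := - y * z) E1 F2); ring.
- by apply: (linear_combination2 (c := 1) (c' := - y * z) E2 F4); ring.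
exists (- s1), (- s2); split.
- by apply: (linear_combination1 (c := 1) G1); ring.
- by rewrite F2; ring.
- by apply: (linear_combination1 (c := 1) G2); ring.
- by rewrite F4; ring.
- by rewrite F5; ring.
Qed.

Lemma kernel_phi3_3 w1 w2 : y * z * w1 = 0 -> y * z * w2 = 0 -> w1 = 0 /\ w2 = 0.
Proof.
have nz : y * z != 0 by rewrite mulf_neq0 ?expf_neq0 ?cubic_y_neq0.
by move=> E1 E2; split; apply: (mulfI nz); rewrite ?E1 ?E2 mulr0.
Qed.

(** Regularity of y^a puts x1 v4 + x2 v5 + y v6 in the cubic ideal. The quadrics are
themselves visible combinations of x1, x2, y, so v4, v5, v6 are known up to a
Koszul relation; removing them leaves a syzygy of the quadrics. *)
Lemma kernel_phi1_1 v1 v2 v3 v4 v5 v6 :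
    q1 * v1 + q2 * v2 + q3 * v3 + x1 * z * v4 + x2 * z * v5 + y * z * v6 = 0 ->
  exists w1 w2 w3 w4, exists w5 w6 w7 w8,
  [/\ v1 = x2 * w1 + z * w2 - y * w3, v2 = - (x1 * w1) + x2 * w3 + z * w4
    & v3 = x0 * w1 - x1 * w3 + z * w5] /\
  [/\ v4 = - (x1 * w2) - x2 * w4 + x2 * w6 + y * w7,
      v5 = x0 * w2 - x2 * w5 - x1 * w6 + y * w8
    & v6 = x0 * w4 + x1 * w5 - x1 * w7 - x2 * w8].
Proof.
move=> E.
have [|c1 [c2 [c3 Ec]]] :=
    @cubic_y_regular reg a (x1 * v4 + x2 * v5 + y * v6).
  exists (- v1), (- v2), (- v3).
  by apply: (linear_combination1 (c := 1) E); rewrite -/z; ring.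
(* q1 = x1 x1 - x0 x2, q2 = x2 x1 - x0 y and q3 = x2 x2 - x1 y are moved to the
   coefficients of x1, x2, y. *)
have [|r [s [t [E4 E5 E6]]]] := @cubic_koszul3 reg
    (v4 - c1 * x1 - c2 * x2) (v5 + c1 * x0 - c3 * x2) (v6 + c2 * x0 + c3 * x1).
  by apply: (linear_combination1 (c := 1) Ec); rewrite /q1 /q2 /q3; ring.
have [|w1 [w3 [E1 E2 E3]]] :=
    @cubic_syzygies (v1 + z * c1) (v2 + z * c2) (v3 + z * c3).
  by apply: (linear_combination2 (c := 1) (c' := - z) E Ec); ring.
exists w1, (- c1), w3, (- c2); exists (- c3), r, s, t; split; split.
- by apply: (linear_combination1 (c := 1) E1); ring.
- by apply: (linear_combination1 (c := 1) E2); ring.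
- by apply: (linear_combination1 (c := 1) E3); ring.
- by apply: (linear_combination1 (c := 1) E4); ring.
- by apply: (linear_combination1 (c := 1) E5); ring.
- by apply: (linear_combination1 (c := 1) E6); ring.
Qed.

(** The quadrics annihilate M, so combining the first three rows with coefficients
q1, q2, q3 eliminates v1 and v3 and makes (v2, v4, v5) a syzygy M s. What remains
of v6, v7, v8 is a Koszul relation between x2 and y. *)
Lemma kernel_phi2_1 v1 v2 v3 v4 v5 v6 v7 v8 :
    x2 * v1 + z * v2 - y * v3 = 0 ->
    - (x1 * v1) + x2 * v3 + z * v4 = 0 ->
    x0 * v1 - x1 * v3 + z * v5 = 0 ->
    - (x1 * v2) - x2 * v4 + x2 * v6 + y * v7 = 0 ->
    x0 * v2 - x2 * v5 - x1 * v6 + y * v8 = 0 ->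
  exists w1 w2 w3,
  [/\ v1 = z * w1, v2 = - (x2 * w1) + y * w2, v3 = z * w2
    & v4 = x1 * w1 - x2 * w2] /\
  [/\ v5 = - (x0 * w1) + x1 * w2, v6 = - (x2 * w2) + y * w3,
      v7 = x1 * w2 - x2 * w3 & v8 = - (x0 * w2) + x1 * w3].
Proof.
move=> E1 E2 E3 E4 E5.
have nzz : z != 0 by rewrite expf_neq0 ?cubic_y_neq0.
have E12 : q1 * (x2 * v1 + z * v2 - y * v3)
    + q2 * (- (x1 * v1) + x2 * v3 + z * v4) = 0.
  by rewrite E1 E2 !mulr0 addr0.
have [|s1 [s2 [F2 F4 F5]]] := @cubic_syzygies v2 v4 v5.
  apply: (mulfI nzz); apply: (linear_combination2 (c := 1) (c' := q3) E12 E3).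
  by rewrite /q1 /q2 /q3; ring.
have [||G1 G3] := @cubic_syzygies_injective (v1 + z * s1) (v3 + z * s2).
- by apply: (linear_combination2 (c := 1) (c' := - z) E1 F2); ring.
- by apply: (linear_combination2 (c := 1) (c' := - z) E2 F4); ring.
have [|h [G6 G7]] := @cubic_koszul2 reg (v6 - x2 * s2) (v7 + x1 * s2).
  by rewrite -[RHS]E4 F2 F4; ring.
exists (- s1), (- s2), h; split; split.
- by apply: (linear_combination1 (c := 1) G1); ring.
- by rewrite F2; ring.
- by apply: (linear_combination1 (c := 1) G3); ring.
- by rewrite F4; ring.
- by rewrite F5; ring.
- by apply: (linear_combination1 (c := 1) G6); ring.
- by apply: (linear_combination1 (c := 1) G7); ring.
- apply: (mulfI (cubic_y_neq0 reg)).
  apply: (linear_combination2 (c := 1) (c' := x1) E5 G6).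
  by rewrite F2 F5; ring.
Qed.

Lemma kernel_phi3_1 w1 w2 w3 : z * w1 = 0 -> z * w2 = 0 -> - (x2 * w2) + y * w3 = 0 ->
  [/\ w1 = 0, w2 = 0 & w3 = 0].
Proof.
have nz : z != 0 by rewrite expf_neq0 ?cubic_y_neq0.
move=> E1 E2 E3; have w20 : w2 = 0 by apply: (mulfI nz); rewrite E2 mulr0.
split=> //; first by apply: (mulfI nz); rewrite E1 mulr0.
apply: (mulfI (cubic_y_neq0 reg)).
by apply: (linear_combination1 (c := 1) E3); rewrite w20; ring.
Qed.

(** As for b = 1, but with the coefficient of x1 equal to zero. That condition is a
second Koszul relation on x1, x2, y, and supplies the witnesses. *)
Lemma kernel_phi1_2 v1 v2 v3 v4 v5 :
    q1 * v1 + q2 * v2 + q3 * v3 + x2 * z * v4 + y * z * v5 = 0 ->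
  exists w1 w2 w3 w4 w5,
  [/\ v1 = x2 * w1 - y * w2, v2 = - (x1 * w1) + x2 * w2 + z * w3,
      v3 = x0 * w1 - x1 * w2 + z * w4, v4 = - (x1 * w3) - x2 * w4 + y * w5
    & v5 = x0 * w3 + x1 * w4 - x2 * w5].
Proof.
move=> E.
have [|c1 [c2 [c3 Ec]]] := @cubic_y_regular reg a (x2 * v4 + y * v5).
  exists (- v1), (- v2), (- v3).
  by apply: (linear_combination1 (c := 1) E); rewrite -/z; ring.
have [|r [s [t [E3 E4 E5]]]] := @cubic_koszul3 reg
    (- c1 * x1 - c2 * x2) (v4 + c1 * x0 - c3 * x2) (v5 + c2 * x0 + c3 * x1).
  by apply: (linear_combination1 (c := 1) Ec); rewrite /q1 /q2 /q3; ring.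
have [|r' [s' [t' [F1 F2 F3]]]] := @cubic_koszul3 reg c1 (c2 + r) s.
  by apply: (linear_combination1 (c := -1) E3); ring.
(* Solved for so that the last two rows of phi_2 return v4 and v5. *)
pose w3 := - c2 - x2 * s' - x1 * r'.
pose w4 := - c3 + x1 * s' + x0 * r'.
pose w5 := t - x1 * t' - x0 * s'.
have G4 : v4 = - (x1 * w3) - x2 * w4 + y * w5.
  apply: (linear_combination2 (c := 1) (c' := - x1) E4 F2).
  by rewrite F1 /w3 /w4 /w5; ring.
have G5 : v5 = x0 * w3 + x1 * w4 - x2 * w5.
  by apply: (linear_combination1 (c := 1) E5); rewrite F3 /w3 /w4 /w5; ring.
have [|w1 [w2 [G1 G2 G3]]] := @cubic_syzygies v1 (v2 - z * w3) (v3 - z * w4).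
  by apply: (linear_combination1 (c := 1) E); rewrite G4 G5 /q1 /q2 /q3; ring.
exists w1, w2, w3, w4, w5; split=> //.
- by apply: (linear_combination1 (c := 1) G2); ring.
- by apply: (linear_combination1 (c := 1) G3); ring.
Qed.

(** Reversing the columns of phi_2 and changing the sign of the middle one makes it
skew-symmetric, with the entries of phi_1 as Pfaffians up to sign, and these span
its kernel over the field of fractions. Eliminating v4 from the last two rows gives
q1 v3 + q3 v5 = 0, which produces the common factor w; the other coordinates
follow after cancelling q1. *)
Lemma kernel_phi2_2 v1 v2 v3 v4 v5 :
    - (x1 * v1) + x2 * v2 + z * v3 = 0 ->
    x0 * v1 - x1 * v2 + z * v4 = 0 ->
    - (x1 * v3) - x2 * v4 + y * v5 = 0 ->
    x0 * v3 + x1 * v4 - x2 * v5 = 0 ->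
  exists w, [/\ v1 = y * z * w, v2 = x2 * z * w, v3 = - (q3 * w), v4 = q2 * w
              & v5 = q1 * w].
Proof.
move=> E2 E3 E4 E5; have nz1 := cubic_q1_neq0 reg.
have [|w [F3 F5]] := @coprime_quotient (- v3) v5.
  by apply: (linear_combination2 (c := x1) (c' := x2) E4 E5); rewrite /q1 /q3; ring.
have G4 : v4 = q2 * w.
  apply: (mulfI nz1); apply: (linear_combination2 (c := x0) (c' := x1) E4 E5).
  by rewrite F5 /q1 /q2; ring.
have G3 : v3 = - (q3 * w) by rewrite -F3 opprK.
exists w; split=> //; apply: (mulfI nz1).
- apply: (linear_combination2 (c := - x1) (c' := - x2) E2 E3).
  by rewrite G3 G4 /q1 /q2 /q3; ring.
- apply: (linear_combination2 (c := - x0) (c' := - x1) E2 E3).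
  by rewrite G3 G4 /q1 /q2 /q3; ring.
Qed.

Lemma kernel_phi3_2 w : y * z * w = 0 -> w = 0.
Proof. by move=> E; case: (kernel_phi3_3 E E). Qed.

End CubicSyzygies.

(** * Ideals and straightening of monomials *)

Record is_ideal (R : pzRingType) (J : R -> Prop) : Prop := IsIdeal {
  ideal0 : J 0;
  idealD : forall f g, J f -> J g -> J (f + g);
  idealM : forall c f, J f -> J (c * f) }.

Section Ideals.
Variables (R : comNzRingType) (J : R -> Prop).
Hypothesis idJ : is_ideal J.

Lemma idealN f : J f -> J (- f).
Proof. by move=> Jf; rewrite -mulN1r; apply: (idealM idJ). Qed.

Lemma ideal_mulr c f : J f -> J (f * c).
Proof. by rewrite mulrC; apply: (idealM idJ). Qed.

Lemma ideal_sum (I : Type) (r : seq I) (P : pred I) (F : I -> R) :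
  (forall i, P i -> J (F i)) -> J (\sum_(i <- r | P i) F i).
Proof.
move=> JF; elim/big_rec: _ => [|i f Pi Jf]; first exact: ideal0 idJ.
by apply: (idealD idJ) => //; apply: JF.
Qed.

Lemma ideal_congr_sym f g : J (f - g) -> J (g - f).
Proof. by move=> /idealN; rewrite opprB. Qed.

Lemma ideal_congr_trans g f h : J (f - g) -> J (g - h) -> J (f - h).
Proof. by move=> Jfg Jgh; rewrite -(subrKA g); apply: (idealD idJ). Qed.

Lemma ideal_congr f g : J (f - g) -> J g -> J f.
Proof. by move=> Jfg Jg; rewrite -(subrK g f); apply: (idealD idJ). Qed.

Lemma ideal_congr_mul f g f' g' : J (f - g) -> J (f' - g') -> J (f * f' - g * g').
Proof.
move=> Jfg Jfg'; have -> : f * f' - g * g' = f' * (f - g) + g * (f' - g') by ring.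
by apply: (idealD idJ); apply: (idealM idJ).
Qed.

Lemma ideal_congr_exp f g n : J (f - g) -> J (f ^+ n - g ^+ n).
Proof.
move=> Jfg; elim: n => [|n IHn]; first by rewrite !expr0 subrr; apply: ideal0 idJ.
by rewrite !exprS; apply: ideal_congr_mul.
Qed.

Lemma ideal_gen_sub S : (forall f, S f -> J f) ->
  forall f, ideal_gen S f -> J f.
Proof.
move=> SJ f [l [c [g [Sg ->]]]].
by apply: ideal_sum => j _; apply: (idealM idJ); apply: SJ.
Qed.

End Ideals.

Lemma ideal_gen_is_ideal (R : comNzRingType) (S : R -> Prop) :
  is_ideal (ideal_gen S).
Proof.
split.
- exists 0%N, (fun=> 0), (fun=> 0); split; first by case.
  by rewrite big_ord0.
- move=> f f' [l [c [g [Sg ->]]]] [l' [c' [g' [Sg' ->]]]].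
  pose join (u : 'I_l -> R) u' (j : 'I_(l + l')) :=
    match split j with inl i => u i | inr i => u' i end.
  exists (l + l')%N, (join c c'), (join g g'); split.
    by move=> j; rewrite /join; case: split.
  rewrite big_split_ord /=; congr (_ + _); apply: eq_bigr => i _; rewrite /join.
    by rewrite (unsplitK (inl i)).
  by rewrite (unsplitK (inr i)).
- move=> d f [l [c [g [Sg ->]]]]; exists l, (fun j => d * c j), g; split=> //.
  by rewrite mulr_sumr; apply: eq_bigr => j _; rewrite mulrA.
Qed.

Lemma mem_ideal_gen (R : comNzRingType) (S : R -> Prop) f :
  S f -> ideal_gen S f.
Proof.
move=> Sf; exists 1%N, (fun=> 1), (fun=> f); split=> //.
by rewrite big_ord1 mul1r.
Qed.

Lemma principal_is_ideal (R : comNzRingType) (q : R) :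
  is_ideal (fun f => exists h, f = q * h).
Proof.
split; first by exists 0; rewrite mulr0.
  by move=> _ _ [f ->] [g ->]; exists (f + g); rewrite mulrDr.
by move=> c _ [f ->]; exists (c * f); rewrite mulrCA.
Qed.

Section CubicIdeal.
Variables (R : idomainType) (x0 x1 x2 y : R).
Let q1 := x1 ^+ 2 - x0 * x2.
Let q2 := x1 * x2 - x0 * y.
Let q3 := x2 ^+ 2 - x1 * y.

Lemma cubic_ideal_is_ideal : is_ideal (cubic_ideal x0 x1 x2 y).
Proof.
split; first by exists 0, 0, 0; rewrite !mul0r !addr0.
  move=> _ _ [u1 [u2 [u3 ->]]] [w1 [w2 [w3 ->]]].
  by exists (u1 + w1), (u2 + w2), (u3 + w3); ring.
by move=> c _ [u1 [u2 [u3 ->]]]; exists (c * u1), (c * u2), (c * u3); ring.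
Qed.

Lemma cubic_ideal_gens : [/\ cubic_ideal x0 x1 x2 y q1,
  cubic_ideal x0 x1 x2 y q2 & cubic_ideal x0 x1 x2 y q3].
Proof.
split; [exists 1, 0, 0|exists 0, 1, 0|exists 0, 0, 1]; rewrite /q1 /q2 /q3; ring.
Qed.

Let mon e0 e1 e2 e3 := x0 ^+ e0 * x1 ^+ e1 * x2 ^+ e2 * y ^+ e3.

(** Each use of x2^2 = x1 y lowers the exponent of x2 by two and preserves the two
linear forms, which determine the exponents once the one of x2 is at most 1. *)
Lemma reduce_q3 (J : R -> Prop) e0 e1 e2 e3 : is_ideal J -> J q3 ->
  exists f1 f2 f3, [/\ (f2 <= 1)%N, (2 * f1 + f2 = 2 * e1 + e2)%N,
    (f2 + 2 * f3 = e2 + 2 * e3)%N & J (mon e0 e1 e2 e3 - mon e0 f1 f2 f3)].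
Proof.
move=> idJ J3; have [n] := ubnP e2; elim: n e1 e2 e3 => // n IHn e1 e2 e3.
case: e2 => [|[|e2]] lt_e2n.
- by exists e1, 0%N, e3; split=> //; rewrite subrr; apply: ideal0 idJ.
- by exists e1, 1%N, e3; split=> //; rewrite subrr; apply: ideal0 idJ.
have [|f1 [f2 [f3 [le1 E1 E2 Jf]]]] := IHn e1.+1 e2 e3.+1; first by lia.
exists f1, f2, f3; split=> //; [by lia | by lia |].
apply: ideal_congr_trans Jf => //.
have -> : mon e0 e1 e2.+2 e3 - mon e0 e1.+1 e2 e3.+1 = mon e0 e1 e2 e3 * q3.
  by rewrite /mon /q3 !exprS; ring.
exact: idealM.
Qed.

(** Each of the three relations lowers e1 + e2 while preserving the degree and
e1 + 2 e2 + 3 e3. These two numbers determine a monomial with e1 + e2 <= 1. *)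
Lemma reduce_cubic (J : R -> Prop) e0 e1 e2 e3 :
    is_ideal J -> J q1 -> J q2 -> J q3 ->
  exists f0 f1 f2 f3, [/\ (f1 + f2 <= 1)%N,
    (f0 + f1 + f2 + f3 = e0 + e1 + e2 + e3)%N,
    (f1 + 2 * f2 + 3 * f3 = e1 + 2 * e2 + 3 * e3)%N
    & J (mon e0 e1 e2 e3 - mon f0 f1 f2 f3)].
Proof.
move=> idJ J1 J2 J3; have [n] := ubnP (e1 + e2).
elim: n e0 e1 e2 e3 => // n IHn e0 e1 e2 e3 lt_n.
have step e0' e1' e2' e3' : (e1' + e2' < n)%N ->
    (e0' + e1' + e2' + e3' = e0 + e1 + e2 + e3)%N ->
    (e1' + 2 * e2' + 3 * e3' = e1 + 2 * e2 + 3 * e3)%N ->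
    J (mon e0 e1 e2 e3 - mon e0' e1' e2' e3') ->
  exists f0 f1 f2 f3, [/\ (f1 + f2 <= 1)%N,
    (f0 + f1 + f2 + f3 = e0 + e1 + e2 + e3)%N,
    (f1 + 2 * f2 + 3 * f3 = e1 + 2 * e2 + 3 * e3)%N
    & J (mon e0 e1 e2 e3 - mon f0 f1 f2 f3)].
  move=> lt' E1 E2 Jf.
  have [f0 [f1 [f2 [f3 [le1 F1 F2 Jf']]]]] := IHn e0' e1' e2' e3' lt'.
  exists f0, f1, f2, f3; split=> //; [by lia | by lia |].
  exact: ideal_congr_trans Jf Jf'.
case: e1 e2 lt_n step => [|[|e1]] [|[|e2]] lt_n step.
- by exists e0, 0%N, 0%N, e3; split=> //; rewrite subrr; apply: ideal0 idJ.
- by exists e0, 0%N, 1%N, e3; split=> //; rewrite subrr; apply: ideal0 idJ.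
- apply: (step e0 1%N e2 e3.+1); [by lia | by lia | by lia |].
  have -> : mon e0 0 e2.+2 e3 - mon e0 1 e2 e3.+1 = mon e0 0 e2 e3 * q3.
    by rewrite /mon /q3 !exprS; ring.
  exact: idealM.
- by exists e0, 1%N, 0%N, e3; split=> //; rewrite subrr; apply: ideal0 idJ.
- apply: (step e0.+1 0%N 0%N e3.+1); [by lia | by lia | by lia |].
  have -> : mon e0 1 1 e3 - mon e0.+1 0 0 e3.+1 = mon e0 0 0 e3 * q2.
    by rewrite /mon /q2 !exprS; ring.
  exact: idealM.
- apply: (step e0.+1 0%N e2.+1 e3.+1); [by lia | by lia | by lia |].
  have -> : mon e0 1 e2.+2 e3 - mon e0.+1 0 e2.+1 e3.+1 = mon e0 0 e2.+1 e3 * q2.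
    by rewrite /mon /q2 !exprS; ring.
  exact: idealM.
- apply: (step e0.+1 e1 1%N e3); [by lia | by lia | by lia |].
  have -> : mon e0 e1.+2 0 e3 - mon e0.+1 e1 1 e3 = mon e0 e1 0 e3 * q1.
    by rewrite /mon /q1 !exprS; ring.
  exact: idealM.
- apply: (step e0.+1 e1 2%N e3); [by lia | by lia | by lia |].
  have -> : mon e0 e1.+2 1 e3 - mon e0.+1 e1 2 e3 = mon e0 e1 1 e3 * q1.
    by rewrite /mon /q1 !exprS; ring.
  exact: idealM.
- apply: (step e0.+1 e1 e2.+3 e3); [by lia | by lia | by lia |].
  have -> : mon e0 e1.+2 e2.+2 e3 - mon e0.+1 e1 e2.+3 e3 = mon e0 e1 e2.+2 e3 * q1.
    by rewrite /mon /q1 !exprS; ring.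
  exact: idealM.
Qed.

End CubicIdeal.

(** * Toric maps and the polynomial ring in four variables *)

Local Notation O0 := (@Ordinal 4 0 isT).
Local Notation O1 := (@Ordinal 4 1 isT).
Local Notation O2 := (@Ordinal 4 2 isT).
Local Notation O3 := (@Ordinal 4 3 isT).

Lemma big_ord4 (R : Type) (idx : R) (op : Monoid.law idx) (F : 'I_4 -> R) :
  \big[op/idx]_(i < 4) F i = op (F O0) (op (F O1) (op (F O2) (F O3))).
Proof.
rewrite !big_ord_recl big_ord0 Monoid.mulm1.
by do !congr (op _ _); congr (F _); apply: val_inj.
Qed.

Lemma forall_ord4 (P : 'I_4 -> Prop) : P O0 -> P O1 -> P O2 -> P O3 -> forall i, P i.
Proof.
move=> P0 P1 P2 P3 [[|[|[|[|//]]]] lt_i4].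
- by have -> : Ordinal lt_i4 = O0 by apply: val_inj.
- by have -> : Ordinal lt_i4 = O1 by apply: val_inj.
- by have -> : Ordinal lt_i4 = O2 by apply: val_inj.
- by have -> : Ordinal lt_i4 = O3 by apply: val_inj.
Qed.

Definition ffun4 (T : Type) (t0 t1 t2 t3 : T) (i : 'I_4) : T :=
  nth t0 [:: t0; t1; t2; t3] i.

Definition mono4 (e0 e1 e2 e3 : nat) : 'X_{1..4} :=
  [multinom ffun4 e0 e1 e2 e3 i | i < 4].

Lemma mono4E e0 e1 e2 e3 i : mono4 e0 e1 e2 e3 i = ffun4 e0 e1 e2 e3 i.
Proof. exact: mnmE. Qed.

Lemma mdeg4 (e : 'X_{1..4}) : mdeg e = (e O0 + e O1 + e O2 + e O3)%N.
Proof. by rewrite mdegE big_ord4 /= !addnA. Qed.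

(** The exponent of t when x0, x1, x2, y are replaced by u, u t, u t^2, u t^3. *)
Definition cubic_degree (e : 'X_{1..4}) : nat := (e O1 + 2 * e O2 + 3 * e O3)%N.

Section Polynomials.
Variable k : fieldType.
Local Notation R := {mpoly k[4]}.
Local Notation x0 := ('X_O0 : R).
Local Notation x1 := ('X_O1 : R).
Local Notation x2 := ('X_O2 : R).
Local Notation y := ('X_O3 : R).

Lemma mpolyX4 (e : 'X_{1..4}) :
  'X_[e] = x0 ^+ e O0 * x1 ^+ e O1 * x2 ^+ e O2 * y ^+ e O3.
Proof. by rewrite mpolyXE_id big_ord4 /= !mulrA. Qed.

Lemma mpolyX_mono4 e0 e1 e2 e3 :
  'X_[mono4 e0 e1 e2 e3] = x0 ^+ e0 * x1 ^+ e1 * x2 ^+ e2 * y ^+ e3.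
Proof. by rewrite mpolyX4 !mono4E. Qed.

(** Monomials in one fibre of h agree modulo J, so f is congruent to a sum over the
fibres of one monomial times the sum of the coefficients of f on that fibre. *)
Lemma fiber_ideal (J : R -> Prop) (T : eqType) (h : 'X_{1..4} -> T) (f : R) :
    is_ideal J ->
    (forall e e', h e = h e' -> J ('X_[e] - 'X_[e'])) ->
    (forall e, J 'X_[e] \/ \sum_(e' <- msupp f | h e' == h e) f@_e' = 0) ->
  J f.
Proof.
move=> idJ Jh sumf; rewrite (mpolyE f).
pose s := undup (map h (msupp f)).
have -> : \sum_(e <- msupp f) f@_e *: 'X_[e] =
    \sum_(t <- s) \sum_(e <- msupp f | h e == t) f@_e *: ('X_[e] : R).
  under [RHS]eq_bigr do rewrite big_mkcond.
  rewrite exchange_big /= big_seq [RHS]big_seq; apply: eq_bigr => e e_f.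
  rewrite (bigD1_seq (h e)) ?undup_uniq ?mem_undup ?map_f //= eqxx.
  by rewrite big1 ?addr0 // => t; rewrite eq_sym => /negPf->.
rewrite big_seq; apply: (ideal_sum idJ) => t.
rewrite mem_undup => /mapP [e0 _ ->] {t}.
have -> : \sum_(e <- msupp f | h e == h e0) f@_e *: ('X_[e] : R) =
    \sum_(e <- msupp f | h e == h e0) (f@_e)%:MP * ('X_[e] - 'X_[e0]) +
    (\sum_(e <- msupp f | h e == h e0) f@_e)%:MP * 'X_[e0].
  rewrite raddf_sum mulr_suml -big_split /=; apply: eq_bigr => e _.
  by rewrite mulrBr subrK mul_mpolyC.
apply: (idealD idJ).
  by apply: (ideal_sum idJ) => e /eqP /Jh; apply: (idealM idJ).
by case: (sumf e0) => [|->]; [apply: (idealM idJ) | rewrite mul0r; apply: ideal0 idJ].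
Qed.

(** Modulo J the substitution is the identity on the variables, hence everywhere. *)
Lemma substitution_congr (J : R -> Prop) (g : 'I_4 -> R) (f : R) :
  is_ideal J -> (forall i, J ('X_i - g i)) -> J (f - mmap (@mpolyC 4 k) g f).
Proof.
move=> idJ Jg; rewrite {1}(mpolyE f) /mmap -sumrB; apply: (ideal_sum idJ) => e _.
rewrite -mul_mpolyC -mulrBr; apply: (idealM idJ).
rewrite mpolyXE_id /mmap1; elim/big_rec2: _ => [|i f1 f2 _ Jf].
  by rewrite subrr; apply: ideal0 idJ.
by apply: ideal_congr_mul => //; apply: ideal_congr_exp.
Qed.

(** The exponent of the image of X^e under the monomial map x_i -> X^(A i). *)
Definition toric_exponent (A : 'I_4 -> 'X_{1..4}) (e : 'X_{1..4}) : 'X_{1..4} :=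
  (\big[+%MM/0%MM]_(i < 4) (A i *+ e i))%MM.

Lemma toric_exponentE A e j :
  toric_exponent A e j = (\sum_(i < 4) A i j * e i)%N.
Proof. by rewrite mnm_sumE; apply: eq_bigr => i _; rewrite mulmnE. Qed.

Lemma mcoeff_toric A (f : R) t :
  (mmap (@mpolyC 4 k) (fun i => 'X_[A i]) f)@_t =
  \sum_(e <- msupp f | toric_exponent A e == t) f@_e.
Proof.
rewrite /mmap raddf_sum [RHS]big_mkcond /=; apply: eq_bigr => e _.
have -> : mmap1 (fun i => 'X_[A i]) e = 'X_[toric_exponent A e] :> R.
  rewrite /toric_exponent (big_morph _ (@mpolyXD 4 k) (mpolyX0 4 k)).
  by apply: eq_bigr => i _; rewrite mpolyXn.
by rewrite mcoeffCM mcoeffX; case: eqP => _; rewrite ?mulr1 ?mulr0.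
Qed.

(** The coefficients of the image of f are the sums of its coefficients on the fibres
of the exponent map. *)
Lemma toric_kernel (J : R -> Prop) A (f : R) :
    is_ideal J ->
    (forall e e', toric_exponent A e = toric_exponent A e' ->
      J ('X_[e] - 'X_[e'])) ->
    mmap (@mpolyC 4 k) (fun i => 'X_[A i]) f = 0 -> J f.
Proof.
move=> idJ JA f0; apply: (fiber_ideal (h := toric_exponent A)) => // e; right.
by rewrite -mcoeff_toric f0 mcoeff0.
Qed.

Local Notation q1 := (x1 ^+ 2 - x0 * x2).
Local Notation q2 := (x1 * x2 - x0 * y).
Local Notation q3 := (x2 ^+ 2 - x1 * y).

(** The quadric cone x2^2 = x1 y, parametrised by x1 = s^2, x2 = s t, y = t^2. *)
Definition q3_exponent : 'I_4 -> 'X_{1..4} := ffun4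
  (mono4 1 0 0 0) (mono4 0 2 0 0) (mono4 0 1 1 0) (mono4 0 0 2 0).

Lemma q3_kernel f :
  mmap (@mpolyC 4 k) (fun i => 'X_[q3_exponent i]) f = 0 ->
  exists h, f = q3 * h.
Proof.
have idJ := principal_is_ideal q3.
have Jq3 : exists h, q3 = q3 * h by exists 1; rewrite mulr1.
move=> f0; refine (toric_kernel idJ (A := q3_exponent) _ f0) => e e' Ee.
rewrite (mpolyX4 e) (mpolyX4 e').
have [f1 [f2 [f3 [le1 E1 E2 Jf]]]] :=
  reduce_q3 x0 (e O0) (e O1) (e O2) (e O3) idJ Jq3.
have [f1' [f2' [f3' [le1' E1' E2' Jf']]]] :=
  reduce_q3 x0 (e' O0) (e' O1) (e' O2) (e' O3) idJ Jq3.
have := congr1 (fun t : 'X_{1..4} => t O0) Ee.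
have := congr1 (fun t : 'X_{1..4} => t O1) Ee.
have := congr1 (fun t : 'X_{1..4} => t O2) Ee.
rewrite /= !toric_exponentE !big_ord4 /= !mono4E /ffun4 /= => D2 D1 D0.
have [e0E f1E f2E f3E] : [/\ e O0 = e' O0, f1 = f1', f2 = f2' & f3 = f3'].
  by split; lia.
apply: (ideal_congr_trans idJ Jf); rewrite e0E f1E f2E f3E.
exact: (ideal_congr_sym idJ).
Qed.

(** The cone over the twisted cubic, parametrised by u, u t, u t^2, u t^3. *)
Definition cubic_exponent : 'I_4 -> 'X_{1..4} := ffun4
  (mono4 1 0 0 0) (mono4 1 1 0 0) (mono4 1 2 0 0) (mono4 1 3 0 0).

(** Both monomials straighten to the same one. *)
Lemma cubic_congr (J : R -> Prop) e e' : is_ideal J -> J q1 -> J q2 -> J q3 ->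
  mdeg e = mdeg e' ->
  cubic_degree e = cubic_degree e' ->
  J ('X_[e] - 'X_[e']).
Proof.
move=> idJ J1 J2 J3; rewrite !mdeg4 /cubic_degree => Ed Ec.
rewrite (mpolyX4 e) (mpolyX4 e').
have [f0 [f1 [f2 [f3 [le1 E1 E2 Jf]]]]] :=
  reduce_cubic (e O0) (e O1) (e O2) (e O3) idJ J1 J2 J3.
have [f0' [f1' [f2' [f3' [le1' E1' E2' Jf']]]]] :=
  reduce_cubic (e' O0) (e' O1) (e' O2) (e' O3) idJ J1 J2 J3.
have [f0E f1E f2E f3E] : [/\ f0 = f0', f1 = f1', f2 = f2' & f3 = f3'].
  by split; lia.
apply: (ideal_congr_trans idJ Jf); rewrite f0E f1E f2E f3E.
exact: (ideal_congr_sym idJ).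
Qed.

(** Straightening gives x0^i x_j y^l with j <= 2, where 3 l + j >= 3a+b forces l > a,
or l = a and j >= b. *)
Lemma cubic_degree_large (J : R -> Prop) a b e :
    is_ideal J -> J q1 -> J q2 -> J q3 -> (0 < b)%N ->
    J (y ^+ a.+1) -> ((b <= 2)%N -> J (x2 * y ^+ a)) ->
    ((b <= 1)%N -> J (x1 * y ^+ a)) ->
  (3 * a + b <= cubic_degree e)%N -> J 'X_[e].
Proof.
move=> idJ J1 J2 J3 b_gt0 Jy Jx2 Jx1 le_c; rewrite mpolyX4.
have [f0 [f1 [f2 [f3 [le1 _ Ec Jf]]]]] :=
  reduce_cubic (e O0) (e O1) (e O2) (e O3) idJ J1 J2 J3.
apply: (ideal_congr idJ Jf); move: le_c; rewrite /cubic_degree -Ec => le_c.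
have [le_a|lt_a] := leqP a.+1 f3.
  by rewrite -(subnK le_a) exprD mulrA; apply: (idealM idJ).
have {lt_a}f3E : f3 = a by lia.
subst f3; case: f1 f2 le1 le_c {Ec Jf} => [|[|f1]] [|[|f2]] // le1 le_c.
- by lia.
- by rewrite expr1 -mulrA; apply: (idealM idJ); apply: Jx2; lia.
- rewrite expr1 expr0 mulr1 -mulrA; apply: (idealM idJ); apply: Jx1; lia.
Qed.

Lemma cubic_kernel f :
  mmap (@mpolyC 4 k) (fun i => 'X_[cubic_exponent i]) f = 0 ->
  cubic_ideal x0 x1 x2 y f.
Proof.
have idJ := cubic_ideal_is_ideal x0 x1 x2 y.
have [J1 J2 J3] := cubic_ideal_gens x0 x1 x2 y.
move=> f0; refine (toric_kernel idJ (A := cubic_exponent) _ f0) => e e' Ee.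
have := congr1 (fun t : 'X_{1..4} => t O0) Ee.
have := congr1 (fun t : 'X_{1..4} => t O1) Ee.
rewrite /= !toric_exponentE !big_ord4 /= !mono4E /ffun4 /= => D1 D0.
by apply: cubic_congr => //; rewrite ?mdeg4 /cubic_degree; lia.
Qed.

Lemma mmap_cubic f : cubic_ideal x0 x1 x2 y f ->
  mmap (@mpolyC 4 k) (fun i => 'X_[cubic_exponent i]) f = 0.
Proof.
case=> u1 [u2 [u3 ->]].
rewrite !(rmorphD, rmorphN, rmorphM, rmorphXn) /= !mmapX !mmap1U.
rewrite /cubic_exponent /ffun4 /= (mpolyX_mono4 1 0 0 0) (mpolyX_mono4 1 1 0 0).
by rewrite (mpolyX_mono4 1 2 0 0) (mpolyX_mono4 1 3 0 0); ring.
Qed.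

Lemma mpolyX_neq0 (e : 'X_{1..4}) : 'X_[e] != 0 :> R.
Proof. by rewrite -msupp_eq0 msuppX. Qed.

(** Setting y = 0 in the relation kills f, so y divides f. *)
Lemma koszul2 f g : x2 * f + y * g = 0 ->
  exists h, f = y * h /\ g = - (x2 * h).
Proof.
move=> E; pose s : 'I_4 -> R := ffun4 x0 x1 x2 0.
have [|h Eh] := @substitution_congr (fun f => exists h, f = y * h) s f
  (principal_is_ideal y).
  apply: forall_ord4; rewrite /s /ffun4 /=; try by exists 0; rewrite subrr mulr0.
  by exists 1; rewrite subr0 mulr1.
have sf0 : mmap (@mpolyC 4 k) s f = 0.
  apply: (mulfI (mpolyX_neq0 U_(O2))); rewrite mulr0.
  rewrite -(mmap0 s (@mpolyC 4 k)) -E rmorphD !rmorphM /= !mmapX !mmap1U.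
  by rewrite /s /ffun4 /=; ring.
exists h; rewrite -Eh sf0 subr0; split=> //.
apply: (mulfI (mpolyX_neq0 U_(O3))).
apply: (linear_combination2 (c := 1) (c' := - x2) E Eh); rewrite sf0; ring.
Qed.

(** Setting x2 = y = 0 shows that f lies in (x2, y); subtracting the corresponding
Koszul relations leaves a relation between x2 and y. *)
Lemma koszul3 f g h : x1 * f + x2 * g + y * h = 0 ->
  exists r s t, [/\ f = x2 * r + y * s, g = - (x1 * r) + y * t
                  & h = - (x1 * s) - x2 * t].
Proof.
move=> E; pose s : 'I_4 -> R := ffun4 x0 x1 0 0.
have idJ : is_ideal (fun f => exists r s, f = x2 * r + y * s).
  split; first by exists 0, 0; rewrite !mulr0 addr0.
    by move=> _ _ [r [u ->]] [r' [u' ->]]; exists (r + r'), (u + u'); ring.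
  by move=> c _ [r [u ->]]; exists (c * r), (c * u); ring.
have [|r [u Er]] := @substitution_congr _ s f idJ.
  apply: forall_ord4; rewrite /s /ffun4 /=.
  - by exists 0, 0; ring.
  - by exists 0, 0; ring.
  - by exists 1, 0; ring.
  - by exists 0, 1; ring.
have sf0 : mmap (@mpolyC 4 k) s f = 0.
  apply: (mulfI (mpolyX_neq0 U_(O1))); rewrite mulr0.
  rewrite -(mmap0 s (@mpolyC 4 k)) -E !rmorphD !rmorphM /= !mmapX !mmap1U.
  by rewrite /s /ffun4 /=; ring.
move: Er; rewrite sf0 subr0 => Er.
have [|t [Eg Eh]] := @koszul2 (g + x1 * r) (h + x1 * u).
  by rewrite -[RHS]E Er; ring.
exists r, u, t; split=> //.
  by apply: (linear_combination1 (c := 1) Eg); ring.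
by apply: (linear_combination1 (c := 1) Eh); ring.
Qed.

(** The quotients by q3 and by the cubic ideal embed in domains, so it is enough that
q1 and y have nonzero images there. *)
Lemma cubic_regular_mpoly : cubic_regular x0 x1 x2 y.
Proof.
split.
- exact: mpolyX_neq0.
- apply/eqP => /(congr1 (fun f => f.@[ffun4 0 1 0 0])).
  rewrite !(mevalD, mevalN, mevalM, rmorphXn) /= !mevalXU /ffun4 /= meval0.
  by rewrite ?expr1n mulr1 !(mul0r, mulr0) subr0 => /eqP; rewrite oner_eq0.
- apply/eqP => /(congr1 (fun f => f.@[ffun4 0 0 1 0])).
  rewrite !(mevalD, mevalN, mevalM, rmorphXn) /= !mevalXU /ffun4 /= meval0.
  by rewrite ?expr1n mulr1 !(mul0r, mulr0) subr0 => /eqP; rewrite oner_eq0.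
- move=> f g E; apply: q3_kernel.
  set s := mmap _ _.
  have /eqP : s (q1 * f) = 0.
    rewrite E /s !(rmorphD, rmorphN, rmorphM, rmorphXn) /= !mmapX !mmap1U.
    rewrite /q3_exponent /ffun4 /= (mpolyX_mono4 0 2 0 0).
    by rewrite (mpolyX_mono4 0 1 1 0) (mpolyX_mono4 0 0 2 0); ring.
  rewrite /s rmorphM mulf_eq0 => /orP[|/eqP//].
  rewrite /s !(rmorphD, rmorphN, rmorphM, rmorphXn) /= !mmapX !mmap1U.
  rewrite /q3_exponent /ffun4 /= (mpolyX_mono4 1 0 0 0) (mpolyX_mono4 0 2 0 0).
  rewrite (mpolyX_mono4 0 1 1 0).
  move=> /eqP/(congr1 (fun f => f.@[ffun4 0 1 0 0])).
  rewrite !(mevalD, mevalN, mevalM, rmorphXn) /= !mevalXU /ffun4 /= meval0.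
  by rewrite ?expr1n !(mul1r, mulr1, mul0r, mulr0) subr0 => /eqP; rewrite oner_eq0.
- move=> n f /mmap_cubic; set s := mmap _ _ => /eqP.
  rewrite /s rmorphM rmorphXn mulf_eq0 expf_eq0 => /orP[/andP[_]|/eqP/cubic_kernel//].
  by rewrite /= mmapX mmap1U (negPf (mpolyX_neq0 _)).
- exact: koszul2.
- exact: koszul3.
Qed.

End Polynomials.

(** * The filtration by powers of the maximal ideal *)

Definition weight (m : 'I_4 -> nat) (e : 'X_{1..4}) : nat :=
  (\sum_(i < 4) e i * m i)%N.

(** Some monomial of degree at least i in t^(m 0), ..., t^(m 3) equals t^n. If every
m j is positive, its degree is at most n, so a finite search decides this. *)
Definition reach (m : 'I_4 -> nat) (i n : nat) : bool :=
  [exists e : 'X_{1..4 < n.+1}, (i <= mdeg e)%N && (weight m e == n)].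

Lemma weightD m e e' : weight m (e + e')%MM = (weight m e + weight m e')%N.
Proof. by rewrite -big_split; apply: eq_bigr => i _; rewrite mnmDE mulnDl. Qed.

Lemma weightU m i : weight m U_(i)%MM = m i.
Proof.
rewrite /weight (bigD1 i) //= big1 ?addn0 ?mnm1E ?eqxx ?mul1n // => j.
by rewrite mnm1E eq_sym => /negPf->.
Qed.

Section GradedRing.
Variables (k : fieldType) (m : 'I_4 -> nat).
Hypothesis m_gt0 : forall i, (0 < m i)%N.
Local Notation R := {mpoly k[4]}.

Lemma leq_mdeg_weight e : (mdeg e <= weight m e)%N.
Proof.
by rewrite mdegE; apply: leq_sum => i _; rewrite -{1}[e i]muln1 leq_mul.
Qed.

Lemma reachP i n :
  reflect (exists2 e : 'X_{1..4}, (i <= mdeg e)%N & weight m e = n)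
          (reach m i n).
Proof.
apply: (iffP existsP) => [[e /andP[le_e /eqP]]|[e le_e E]]; first by exists e.
have lt_e : (mdeg e < n.+1)%N by rewrite ltnS -E leq_mdeg_weight.
by exists (BMultinom lt_e); rewrite /= le_e E eqxx.
Qed.

Lemma reach_add i j n p : reach m i n -> reach m j p -> reach m (i + j) (n + p).
Proof.
move=> /reachP[e le_e <-] /reachP[e' le_e' <-]; apply/reachP.
by exists (e + e')%MM; rewrite ?weightD // mdegD leq_add.
Qed.

Lemma reach_gen i : reach m 1 (m i).
Proof. by apply/reachP; exists U_(i)%MM; rewrite ?mdeg1 ?weightU. Qed.

Lemma reachS j n : reach m j.+1 n ->
  exists i, (m i <= n)%N && reach m j (n - m i).
Proof.
move=> /reachP[e lt_je <-].
have [i e_i] : exists i, (0 < e i)%N.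
  apply/existsP; apply: contraLR lt_je => /existsPn e0.
  by rewrite mdegE big1 // => i _; apply/eqP; rewrite -leqn0 leqNgt.
have Ee : e = (U_(i) + (e - U_(i)))%MM.
  by rewrite addmC submK //; apply/mnm_lepP => l; rewrite mnm1E; case: eqP => // <-.
exists i; rewrite Ee weightD weightU leq_addr addKn /=; apply/reachP.
by exists (e - U_(i))%MM => //; move: lt_je; rewrite {1}Ee mdegD mdeg1.
Qed.

Definition supp_in (i : nat) (s : series k) := forall n, s n != 0 -> reach m i n.

Lemma big_neq0 (I : finType) (P : pred I) (F : I -> k) :
  \sum_(i | P i) F i != 0 -> exists2 i, P i & F i != 0.
Proof.
move=> nz; have [i /andP[]|] := pickP (fun i => P i && (F i != 0)).
  by exists i.
move=> no; case/eqP: nz; apply: big1 => i Pi.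
by apply/eqP; have := no i; rewrite Pi /= => /negbFE.
Qed.

(** One monomial per weight suffices: F is supported on chosen monomials. *)
Lemma in_A_supp s : in_A m s <-> supp_in 0 s.
Proof.
split=> [[F sF] n|s_supp].
  rewrite sF => /big_neq0 [e /eqP E _].
  by apply/reachP; exists (e : 'X_{1..4}).
pose rep n := [pick e : 'X_{1..4 < n.+1} | weight m e == n].
pose F e := if rep (weight m e) is Some e' then
  if e' == e :> 'X_{1..4} then s (weight m e) else 0 else 0.
exists F => n; have [s0|nz] := eqVneq (s n) 0.
  rewrite s0 big1 // => e /eqP E; rewrite /F /weight E.
  by case: (rep n) => // e'; case: ifP.
have /reachP[e1 _ E1] := s_supp n nz.
have lt_e1 : (mdeg e1 < n.+1)%N by rewrite ltnS -E1 leq_mdeg_weight.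
case Er : (rep n) => [e0|]; last first.
  move: Er; rewrite /rep; case: pickP => // /(_ (BMultinom lt_e1)) /=.
  by rewrite E1 eqxx.
have E0 : weight m e0 = n.
  by move: Er; rewrite /rep; case: pickP => // e /eqP Ee [<-].
rewrite (bigD1 e0) /=; last by rewrite -/(weight m e0) E0.
rewrite big1 ?addr0 => [|e /andP[/eqP E ne]].
  by rewrite /F E0 Er eqxx.
by rewrite /F /weight E Er -bmeqP eq_sym (negPf ne).
Qed.

(** A series supported on weights reached in degree j + 1 is a sum of p_i t^(m i):
each exponent n is assigned to one i such that n - m i is reached in degree j. *)
Lemma sprod_supp (P Q : series k -> Prop) j :
    (forall s, P s <-> supp_in j s) -> (forall s, Q s -> supp_in 1 s) ->
    (forall i, Q (stpow k (m i))) ->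
  forall s, sprod P Q s <-> supp_in j.+1 s.
Proof.
move=> PE Qsub Qgen s; split=> [[l [p [q [Pp Qq sE]]]] n|s_supp].
  rewrite sE => /big_neq0 [i _] /big_neq0 [r _].
  rewrite mulf_eq0 negb_or => /andP[/((PE _).1 (Pp i)) rj /(Qsub _ (Qq i)) r1].
  by rewrite -addn1 -(subnKC (ltn_ord r : r <= n)%N); apply: reach_add.
pose rep n := [pick i | (m i <= n)%N && reach m j (n - m i)].
pose p i : series k := fun r =>
  if rep (r + m i)%N == Some i then s (r + m i)%N else 0.
exists 4, p, (fun i => stpow k (m i)); split=> // [i|n].
  apply/PE => r; rewrite /p; case: ifP => [/eqP|_]; last by rewrite eqxx.
  rewrite /rep; case: pickP => // i' /andP[_ rj] [E] _.
  by move: rj; rewrite E addnK.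
have prodE i : smul (p i) (stpow k (m i)) n = if rep n == Some i then s n else 0.
  rewrite /smul; have [le_i|lt_i] := leqP (m i) n; last first.
    rewrite big1 => [|r _].
      case: eqP => //; rewrite /rep; case: pickP => // i' /andP[le' _] [E].
      by move: le'; rewrite E leqNgt lt_i.
    rewrite /stpow; case: eqP => [E|_]; last by rewrite mulr0.
    by move: lt_i; rewrite -E ltnNge leq_subr.
  have lt_r : (n - m i < n.+1)%N by rewrite ltnS leq_subr.
  rewrite (bigD1 (Ordinal lt_r)) //= big1 => [|r ne].
    by rewrite subKn // /stpow eqxx mulr1 addr0 /p subnK.
  rewrite /stpow; case: eqP => [E|_]; last by rewrite mulr0.
  by case/eqP: ne; apply: val_inj; rewrite /= -E subKn // -ltnS.
under eq_bigr do rewrite prodE.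
case Er: (rep n) => [i|].
  rewrite (bigD1 i) //= eqxx big1 ?addr0 // => i' /eqP ne.
  by case: eqP => // -[E]; case: ne.
rewrite big1 //; apply/eqP; apply: contraT => /s_supp /reachS [i Ei].
by move: Er; rewrite /rep; case: pickP => // /(_ i); rewrite Ei.
Qed.

Lemma stpow_supp i : supp_in 1 (stpow k (m i)).
Proof.
move=> n; rewrite /stpow; case: (eqVneq n (m i)) => [->|_]; last by rewrite eqxx.
by move=> _; apply: reach_gen.
Qed.

Lemma max_ideal_supp s : max_ideal m s <-> supp_in 1 s.
Proof.
apply: sprod_supp s => [s|s [i Es] n|i]; first exact: in_A_supp.
  by rewrite Es; apply: stpow_supp.
by exists i.
Qed.

(** The powers of the maximal ideal are spanned, as closed subspaces of k[[t]], by the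
powers of t that they contain. *)
Lemma max_pow_supp i s : max_pow m i s <-> supp_in i s.
Proof.
elim: i s => [|i IHi] s /=; first exact: in_A_supp.
apply: sprod_supp s => // [s /max_ideal_supp //|j].
by apply/max_ideal_supp; apply: stpow_supp.
Qed.

Lemma paramD (f g : R) : param m (f + g) = param m f + param m g.
Proof. exact: raddfD. Qed.

Lemma paramN (f : R) : param m (- f) = - param m f.
Proof. exact: raddfN. Qed.

Lemma paramM (f g : R) : param m (f * g) = param m f * param m g.
Proof. exact: rmorphM. Qed.

Lemma paramZ c (f : R) : param m (c *: f) = c%:P * param m f.
Proof. exact: mmapZ. Qed.

Lemma param_sum (I : Type) (r : seq I) (P : pred I) (F : I -> R) :
  param m (\sum_(i <- r | P i) F i) = \sum_(i <- r | P i) param m (F i).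
Proof. exact: raddf_sum. Qed.

Lemma paramX e : param m ('X_[e] : R) = 'X^(weight m e).
Proof.
rewrite /param mmapX /mmap1 /weight.
rewrite (big_morph _ (exprD 'X) (expr0 _)); apply: eq_bigr => i _.
by rewrite -exprM mulnC.
Qed.

Lemma coef_param (f : R) n :
  (param m f)`_n = \sum_(e <- msupp f | weight m e == n) f@_e.
Proof.
rewrite {1}(mpolyE f) param_sum coef_sum [RHS]big_mkcond /=.
apply: eq_bigr => e _; rewrite paramZ.
rewrite paramX coefCM coefXn eq_sym.
by case: eqP => _; rewrite ?mulr1 ?mulr0.
Qed.

Lemma param_reach (f : R) i n : (forall e, f@_e != 0 -> (i <= mdeg e)%N) ->
  (param m f)`_n != 0 -> reach m i n.
Proof.
move=> fi; rewrite coef_param -big_filter; apply: contraR => no.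
rewrite big_seq big1 // => e; rewrite mem_filter => /andP[/eqP E _].
apply/eqP; apply: contraR no => /fi le_ie.
by apply/reachP; exists e.
Qed.

Lemma mcoeff_pihomog d (f : R) e :
  (pihomog mdeg d f)@_e = if mdeg e == d then f@_e else 0.
Proof.
have [nf|nf] := eqVneq f@_e 0.
  rewrite nf if_same pihomogE raddf_sum /= big1_seq // => e' /andP[_ _].
  by rewrite mcoeffZ mcoeffX; case: eqP => [->|]; rewrite ?nf ?mul0r ?mulr0.
rewrite pihomogE raddf_sum /= big_mkcond (bigD1_seq e) ?msupp_uniq //=; last first.
  by rewrite mcoeff_msupp.
rewrite big1 ?addr0 => [|e' /negPf ne]; last first.
  by case: ifP => // _; rewrite mcoeffZ mcoeffX ne mulr0.
by case: ifP => // _; rewrite mcoeffZ mcoeffX eqxx mulr1.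
Qed.

Lemma homog_coeff d (f : R) e : f \is d.-homog -> f@_e != 0 -> mdeg e = d.
Proof.
move=> hf; apply: contraNeq => ne; apply/eqP.
exact: dhomog_nemf_coeff hf ne.
Qed.

(** Recognises an initial form from a splitting into a form of degree s and terms of
higher degree. *)
Lemma init_form_add s (p g : R) : p \is s.-homog -> p != 0 ->
  (forall e, g@_e != 0 -> (s < mdeg e)%N) ->
  p + g != 0 /\ init_form (p + g) = p.
Proof.
move=> hp nzp hg.
have E d : (d <= s)%N -> pihomog mdeg d (p + g) = if d == s then p else 0.
  move=> le_ds; apply/mpolyP => e; rewrite mcoeff_pihomog mcoeffD.
  have g0 : (mdeg e <= s)%N -> g@_e = 0.
    by move=> le_e; apply/eqP; apply: contraLR le_e => /hg; rewrite -ltnNge.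
  have p0 : mdeg e != s -> p@_e = 0 by apply: dhomog_nemf_coeff.
  case: (eqVneq d s) => [->|ne].
    by case: eqP => [e_s|/eqP /p0 ->] //; rewrite g0 ?addr0 ?e_s.
  case: eqP => [e_d|_]; rewrite mcoeff0 //.
  by rewrite g0 ?p0 ?e_d // addr0.
have Es : pihomog mdeg s (p + g) = p by rewrite E // eqxx.
have nz : p + g != 0.
  by apply: contraNneq nzp => pg0; rewrite -Es pg0 pihomog0.
split=> //; rewrite /init_form; suff -> : init_deg (p + g) = s by [].
have lt_s : (s < msize (p + g))%N.
  move: nzp; rewrite -msupp_eq0; case Ep: (msupp p) => [//|e l] _.
  have pe : p@_e != 0 by rewrite -mcoeff_msupp Ep mem_head.
  have e_s := homog_coeff hp pe.
  rewrite -e_s; apply: msize_mdeg_lt; rewrite mcoeff_msupp.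
  by move: pe; rewrite -{1}Es mcoeff_pihomog e_s eqxx.
rewrite /init_deg -(subnKC (ltnW lt_s)) iotaD find_cat add0n.
have -> : has (fun d => pihomog mdeg d (p + g) != 0) (iota 0 s) = false.
  apply/negbTE/hasPn => d; rewrite mem_iota add0n /= => lt_ds.
  by rewrite E ?(ltnW lt_ds) // ltn_eqF // eqxx.
rewrite size_iota -[RHS]addn0; congr (_ + _)%N.
by case Em: (msize (p + g) - s)%N => [|l] /=; [lia | rewrite Es nzp].
Qed.

Lemma init_form_split (f : R) :
  (init_form f \is (init_deg f).-homog) /\
  forall e, (f - init_form f)@_e != 0 -> (init_deg f < mdeg e)%N.
Proof.
split=> [|e]; first exact: pihomogP.
rewrite mcoeffB mcoeff_pihomog; case: ltngtP => // [lt_e|_]; last first.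
  by rewrite subrr eqxx.
rewrite subr0; have [lt_m|le_m] := ltnP (mdeg e) (msize f); last first.
  by rewrite (memN_msupp_eq0 (msize_mdeg_ge le_m)) eqxx.
have := before_find 0%N lt_e; rewrite nth_iota // add0n => /negbFE/eqP.
by move/(congr1 (mcoeff e)); rewrite mcoeff_pihomog eqxx mcoeff0 => ->; rewrite eqxx.
Qed.

Lemma pihomog_mulX i e (f : R) :
  pihomog mdeg i ('X_[e] * f) =
  if (mdeg e <= i)%N then 'X_[e] * pihomog mdeg (i - mdeg e) f else 0.
Proof.
rewrite {1}(mpolyE f) mulr_sumr raddf_sum /=.
have termE e' : pihomog mdeg i ('X_[e] * (f@_e' *: 'X_[e'])) =
    if (mdeg e + mdeg e' == i)%N then f@_e' *: ('X_[e] * 'X_[e']) else 0 :> R.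
  rewrite -scalerAr linearZ /= -mpolyXD pihomogX /= mdegD.
  by case: ifP; rewrite ?scaler0.
under eq_bigr do rewrite termE.
case: leqP => [le_e|lt_e]; last first.
  by rewrite big1 // => e' _; rewrite gtn_eqF // ltn_addr.
rewrite pihomogE mulr_sumr [RHS]big_mkcond; apply: eq_bigr => e' _.
rewrite -(subnKC le_e) eqn_add2l addKn.
by case: eqP => // _; rewrite scalerAr.
Qed.

(** The kernel of the graded map from R to the associated graded ring of A. *)
Definition graded_kernel (f : R) : Prop :=
  forall i n, (param m (pihomog mdeg i f))`_n != 0 -> reach m i.+1 n.

Lemma graded_kernel_is_ideal : is_ideal graded_kernel.
Proof.
have Kadd f g : graded_kernel f -> graded_kernel g -> graded_kernel (f + g).
  move=> Kf Kg i n; rewrite pihomogD.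
  rewrite paramD.
  rewrite coefD; have [f0|/Kf//] := eqVneq (param m (pihomog mdeg i f))`_n 0.
  by rewrite f0 add0r; apply: Kg.
have K0 : graded_kernel 0.
  by move=> i n; rewrite pihomog0 /param mmap0 coef0 eqxx.
split=> // c f Kf; rewrite {1}(mpolyE c) mulr_suml.
elim/big_ind: _ => // e _ i n; rewrite -scalerAl linearZ /=.
rewrite paramZ.
rewrite coefCM mulf_eq0 negb_or => /andP[_]; rewrite pihomog_mulX.
case: leqP => [le_e|lt_e]; last by rewrite /param mmap0 coef0 eqxx.
rewrite paramM.
rewrite paramX coefXnM; case: ltnP => [|le_n]; first by rewrite eqxx.
move/Kf => Kn; rewrite -(subnKC le_n) -(subnKC le_e) -addnS.
by apply: reach_add Kn; apply/reachP; exists e.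
Qed.

(** On the curve f^* equals f^* - f, all of whose terms have degree larger than f^*. *)
Lemma graded_kernel_init (f : R) : curve_ideal m f -> graded_kernel (init_form f).
Proof.
move=> f0 i n; have [hf gt_f] := init_form_split f.
have [->|ne] := eqVneq i (init_deg f); last first.
  by rewrite (pihomog_ne0 _ hf) 1?eq_sym // /param mmap0 coef0 eqxx.
rewrite pihomog_dE // => nz; apply: (param_reach gt_f).
rewrite paramD.
rewrite paramN.
by rewrite f0 add0r coefN oppr_eq0.
Qed.

Lemma tangent_ideal_is_ideal : is_ideal (@tangent_ideal k m).
Proof. exact: ideal_gen_is_ideal. Qed.

Lemma tangent_init s (p g : R) : p \is s.-homog ->
  (forall e, g@_e != 0 -> (s < mdeg e)%N) -> param m (p + g) = 0 ->
  tangent_ideal m p.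
Proof.
move=> hp hg pg0; have [->|nz] := eqVneq p 0; first exact: ideal0 tangent_ideal_is_ideal.
have [nzf Ef] := init_form_add hp nz hg.
by apply: mem_ideal_gen; exists (p + g).
Qed.

(** Each term of f(t^m) is the value of a monomial of degree larger than s. As f(t^m)
is a polynomial in t, finitely many of these give a polynomial g with the same
value as f, and f is the initial form of f - g. *)
Lemma tangent_homog s (f : R) : f \is s.-homog ->
  (forall n, (param m f)`_n != 0 -> reach m s.+1 n) -> tangent_ideal m f.
Proof.
move=> hf Kf; pose c n := (param m f)`_n.
pose rep n : 'X_{1..4} := if [pick e : 'X_{1..4 < n.+1} |
  (s.+1 <= mdeg e)%N && (weight m e == n)] is Some e then e else 0%MM.
have repP n : c n != 0 -> (s.+1 <= mdeg (rep n))%N && (weight m (rep n) == n).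
  move/Kf/existsP => [e Pe]; rewrite /rep.
  by case: pickP => [e' //|/(_ e)]; rewrite Pe.
pose g : R := \sum_(n < size (param m f)) c n *: 'X_[rep n].
apply: (@tangent_init s f (- g)) => // [e|].
  rewrite mcoeffN oppr_eq0 raddf_sum /= => /big_neq0 [n _].
  rewrite mcoeffZ mcoeffX mulf_eq0 negb_or => /andP[/repP/andP[lt_s _]].
  by have [<-|_] := eqVneq (rep n) e; rewrite ?eqxx.
rewrite paramD.
rewrite paramN.
apply/eqP; rewrite subr_eq0; apply/eqP.
rewrite -[LHS]coefK poly_def param_sum; apply: eq_bigr => n _.
rewrite paramZ.
rewrite paramX mul_polyC -/(c n); have [->|/repP/andP[_ /eqP->//]] := eqVneq (c n) 0.
by rewrite !scale0r.
Qed.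

(** For surjectivity in degree i, the quotient m^i/m^(i+1) has a basis of powers t^n
where n is reached in degree i and not beyond, so by a monomial of degree exactly
i; there are finitely many of these. *)
Theorem tangent_presents_gr : presents_gr m (@tangent_ideal k m).
Proof.
split=> [i f hf|i s|f].
- apply/max_pow_supp => n; apply: param_reach => e.
  by move/(homog_coeff hf) ->.
- move/max_pow_supp => s_supp.
  pose rep n := [pick e : 'X_{1..4 < i.+1} | (mdeg e == i) && (weight m e == n)].
  pose f : R := \sum_(e : 'X_{1..4 < i.+1} | rep (weight m e) == Some e)
    s (weight m e) *: 'X_[e].
  have repP n e : rep n = Some e -> mdeg e = i /\ weight m e = n.
    by rewrite /rep; case: pickP => // e' /andP[/eqP ? /eqP ?] [<-].
  exists f.
    by apply: rpred_sum => e /eqP/repP[e_i _]; apply: rpredZ; rewrite dhomogX; apply/eqP.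
  have fE n : param_series m f n = if rep n is Some _ then s n else 0.
    rewrite /param_series param_sum coef_sum.
    have termE (e : 'X_{1..4 < i.+1}) : (param m (s (weight m e) *: ('X_[e] : R)))`_n =
        if n == weight m e then s n else 0.
      rewrite paramZ.
      rewrite paramX coefCM coefXn.
      by case: eqP => [->|_]; rewrite ?mulr1 ?mulr0.
    under eq_bigr do rewrite termE.
    case Er: (rep n) => [e|].
      have [_ e_n] := repP _ _ Er.
      rewrite (bigD1 e) /= ?e_n ?Er ?eqxx // big1 ?addr0 // => e' /andP[/eqP E ne].
      by case: eqP => // n_e'; case/eqP: ne; move: E; rewrite -n_e' Er => -[].
    rewrite big1 // => e /eqP E; case: eqP => // n_e.
    by move: Er; rewrite n_e E.
  apply/max_pow_supp => n; rewrite fE.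
  case Er: (rep n) => [e|]; first by rewrite subrr eqxx.
  rewrite subr0 => /s_supp/reachP[e le_ie e_n].
  apply/reachP; exists e => //; rewrite ltn_neqAle le_ie andbT.
  apply: contraTneq isT => i_e; have lt_e : (mdeg e < i.+1)%N by rewrite -i_e.
  move: Er; rewrite /rep; case: pickP => // /(_ (BMultinom lt_e)) /=.
  by rewrite e_n i_e !eqxx.
- split=> [tf i|Kf].
    apply/max_pow_supp => n; move: i n.
    apply: (ideal_gen_sub graded_kernel_is_ideal) tf => g [h [_ h0 ->]].
    exact: graded_kernel_init.
  rewrite (pihomog_partitionE (p := f) (leqnn (msize f))).
  apply: (ideal_sum tangent_ideal_is_ideal) => i _.
  apply: (tangent_homog (pihomogP _ _ _)) => n.
  exact: ((max_pow_supp _ _).1 (Kf i)).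
Qed.

End GradedRing.

(** * The tangent cone for weights in arithmetic progression *)

(** From (c - c') d = (s' - s) M the modulus M divides c - c', which is less than M. *)
Lemma progression_inj M d s c s' c' : coprime M d -> (0 < d)%N -> (c < M)%N ->
  (s <= s')%N -> (s * M + c * d = s' * M + c' * d)%N -> s = s' /\ c = c'.
Proof.
move=> coMd d_gt0 lt_cM le_s E.
have Ed : ((c - c') * d = (s' - s) * M)%N by rewrite !mulnBl; nia.
have dvM : (M %| c - c')%N by rewrite -(Gauss_dvdl _ coMd) Ed dvdn_mull.
have le_c : (c <= c')%N.
  rewrite -subn_eq0; apply: contraLR dvM; rewrite -lt0n => gt0.
  by apply/negP => /(dvdn_leq gt0); lia.
have le_s' : (s' <= s)%N.
  rewrite -subn_eq0 -(eqn_pmul2r (m := M)); last by lia.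
  by rewrite -Ed (eqP (_ : c - c' == 0)%N) ?subn_eq0.
have es : s = s' by apply/eqP; rewrite eqn_leq le_s.
split=> //; apply/eqP; rewrite -(eqn_pmul2r d_gt0).
by move: E; rewrite es => /addnI ->.
Qed.

Section TangentCone.
Variables (k : fieldType) (m : 'I_4 -> nat) (M d : nat).
Hypothesis mE : forall i : 'I_4, m i = (M + i * d)%N.
Local Notation R := {mpoly k[4]}.
Local Notation x0 := ('X_O0 : R).
Local Notation x1 := ('X_O1 : R).
Local Notation x2 := ('X_O2 : R).
Local Notation y := ('X_O3 : R).
Local Notation q1 := (x1 ^+ 2 - x0 * x2).
Local Notation q2 := (x1 * x2 - x0 * y).
Local Notation q3 := (x2 ^+ 2 - x1 * y).

Lemma weightE e : weight m e = (mdeg e * M + cubic_degree e * d)%N.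
Proof. by rewrite /weight big_ord4 /= !mE mdeg4 /cubic_degree /=; ring. Qed.

(** X^e is the initial form of X^e - X^e'. *)
Lemma tangent_monomial e e' : (mdeg e < mdeg e')%N ->
  weight m e = weight m e' -> tangent_ideal m ('X_[e] : R).
Proof.
move=> lt_e E; apply: (@tangent_init k m (mdeg e) _ (- 'X_[e'])).
- by rewrite dhomogX.
- move=> e''; rewrite mcoeffN oppr_eq0 mcoeffX.
  by have [<-|_] := eqVneq e' e''; rewrite ?eqxx.
rewrite paramD.
rewrite paramN.
by rewrite !paramX E subrr.
Qed.

Lemma tangent_binomial e e' : mdeg e = mdeg e' ->
  cubic_degree e = cubic_degree e' -> tangent_ideal m ('X_[e] - 'X_[e'] : R).
Proof.
move=> Ed Ec; apply: (@tangent_init k m (mdeg e) _ 0).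
- by rewrite rpredB // dhomogX // Ed.
- by move=> e''; rewrite mcoeff0 eqxx.
rewrite addr0; rewrite paramD.
rewrite paramN.
by rewrite !paramX !weightE Ed Ec subrr.
Qed.

Lemma tangent_quadrics :
  [/\ @tangent_ideal k m q1, @tangent_ideal k m q2 & @tangent_ideal k m q3].
Proof.
have step e e' : mdeg e = mdeg e' -> cubic_degree e = cubic_degree e' ->
    tangent_ideal m ('X_[e] - 'X_[e'] : R) by exact: tangent_binomial.
split.
- have := step (mono4 0 2 0 0) (mono4 1 0 1 0).
  rewrite !mdeg4 /cubic_degree !mono4E /ffun4 /= => /(_ erefl erefl).
  rewrite (mpolyX_mono4 _ 0 2 0 0) (mpolyX_mono4 _ 1 0 1 0).
  by rewrite !expr0 !expr1 !mulr1 !mul1r.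
- have := step (mono4 0 1 1 0) (mono4 1 0 0 1).
  rewrite !mdeg4 /cubic_degree !mono4E /ffun4 /= => /(_ erefl erefl).
  rewrite (mpolyX_mono4 _ 0 1 1 0) (mpolyX_mono4 _ 1 0 0 1).
  by rewrite !expr0 !expr1 !mulr1 !mul1r.
- have := step (mono4 0 0 2 0) (mono4 0 1 0 1).
  rewrite !mdeg4 /cubic_degree !mono4E /ffun4 /= => /(_ erefl erefl).
  rewrite (mpolyX_mono4 _ 0 0 2 0) (mpolyX_mono4 _ 0 1 0 1).
  by rewrite !expr0 !expr1 !mulr1 !mul1r.
Qed.

Lemma tangent_mono4 e1 e2 e3 n0 n1 n2 :
    (e1 + e2 + e3 < n0 + n1 + n2)%N ->
    ((e1 + e2 + e3) * M + (e1 + 2 * e2 + 3 * e3) * d =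
     (n0 + n1 + n2) * M + (n1 + 2 * n2) * d)%N ->
  tangent_ideal m (x1 ^+ e1 * x2 ^+ e2 * y ^+ e3).
Proof.
move=> lt_e E; rewrite -[x1 ^+ e1]mul1r -(expr0 x0) -mpolyX_mono4.
apply: (@tangent_monomial _ (mono4 n0 n1 n2 0)).
  by rewrite !mdeg4 !mono4E /ffun4 /=; lia.
by rewrite !weightE !mdeg4 /cubic_degree !mono4E /ffun4 /=; lia.
Qed.

Hypotheses (d_gt0 : (0 < d)%N) (coMd : coprime M d).

(** Let p be an initial form of degree s and (s, c) the bidegree of a monomial. If
c < M, the weight s M + c d is attained in degree at least s by that bidegree only,
so the coefficients of p in bidegree (s, c) add up to a coefficient of f(t^m),
which is zero. [fiber_ideal] concludes. *)
Lemma tangent_sub (J : R -> Prop) :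
    is_ideal J -> J q1 -> J q2 -> J q3 ->
    (forall e, (M <= cubic_degree e)%N -> J 'X_[e]) ->
  forall f, tangent_ideal m f -> J f.
Proof.
move=> idJ J1 J2 J3 JX; apply: (ideal_gen_sub idJ) => _ [f [nzf f0 ->]].
have [hf gt_f] := init_form_split f; set s := init_deg f in hf gt_f.
set p := init_form f in hf gt_f *.
apply: (fiber_ideal (h := fun e => (mdeg e, cubic_degree e))) => // [e e' [Ed Ec]|e].
  exact: cubic_congr Ed Ec.
have [le_M|lt_M] := leqP M (cubic_degree e); [by left; apply: JX | right].
have degp e' : e' \in msupp p -> mdeg e' = s by move/(dhomog_mf hf).
have [e_s|e_s] := eqVneq (mdeg e) s; last first.
  rewrite big_seq_cond big_pred0 // => e'; apply/andP => -[/degp E /eqP[E' _]].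
  by case/eqP: e_s; rewrite -E'.
have -> : \sum_(e' <- msupp p | (mdeg e', cubic_degree e') == (mdeg e, cubic_degree e))
    p@_e' = (param m p)`_(weight m e).
  rewrite coef_param big_seq_cond [RHS]big_seq_cond; apply: eq_bigl => e'.
  apply: andb_id2l => /degp E; rewrite xpair_eqE E e_s eqxx /= !weightE E e_s.
  by rewrite eqn_add2l eqn_pmul2r.
have -> : param m p = - param m (f - p).
  rewrite paramD.
  rewrite paramN.
  by rewrite f0 add0r opprK.
rewrite coefN coef_param big_seq_cond big_pred0 ?oppr0 // => e'.
apply/andP => -[]; rewrite mcoeff_msupp => /gt_f lt_s.
rewrite !weightE => /eqP/esym E.
have [|E' _] := progression_inj coMd d_gt0 lt_M _ E; first by rewrite e_s ltnW.
by move: lt_s; rewrite -E' e_s ltnn.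
Qed.

End TangentCone.

(** * Matrices given by their rows *)

Section MatricesByRows.
Variable k : fieldType.
Local Notation R := {mpoly k[4]}.

Fixpoint dotp (s t : seq R) : R :=
  match s, t with
  | a :: s', b :: t' => a * b + dotp s' t'
  | _, _ => 0
  end.

Definition rows_of p n (r : p.-tuple (n.-tuple R)) : seq (seq R) :=
  [seq val row | row : n.-tuple R <- val r].

Definition dots (r : seq (seq R)) (l : seq R) : seq R := [seq dotp row l | row <- r].

Definition colv n (l : seq R) : 'cV[R]_n := \col_j nth 0 l j.

Lemma dotpE n (s t : seq R) : size s = n -> size t = n ->
  dotp s t = \sum_(j < n) nth 0 s j * nth 0 t j.
Proof.
elim: n s t => [|n IHn] [|a s] [|b t] //=; first by rewrite big_ord0.
by move=> [/IHn sE] [/sE ->]; rewrite big_ord_recl.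
Qed.

Lemma colvP n (v : 'cV[R]_n) : exists2 l, size l = n & v = colv n l.
Proof.
exists [seq v j 0 | j <- enum 'I_n]; first by rewrite size_map size_enum_ord.
apply/matrixP => i j; rewrite ord1 mxE (nth_map i) ?size_enum_ord //.
by rewrite nth_ord_enum.
Qed.

Lemma colv_inj n l l' : size l = n -> size l' = n -> colv n l = colv n l' -> l = l'.
Proof.
move=> ln ln' E; apply: (@eq_from_nth _ 0) => [|i lt_i]; first by rewrite ln.
rewrite ln in lt_i; move/matrixP: E => /(_ (Ordinal lt_i) 0).
by rewrite !mxE.
Qed.

Lemma colv0 n : colv n (nseq n 0) = 0.
Proof. by apply/matrixP => i j; rewrite !mxE nth_nseq ltn_ord. Qed.

Lemma size_dots p n (r : p.-tuple (n.-tuple R)) l : size (dots (rows_of r) l) = p.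
Proof. by rewrite !size_map size_tuple. Qed.

Lemma mul_rows p n (r : p.-tuple (n.-tuple R)) l : size l = n ->
  mx_of_rows r *m colv n l = colv p (dots (rows_of r) l).
Proof.
move=> ln; apply/matrixP => i j; rewrite !mxE.
rewrite (nth_map [::]) ?size_map ?size_tuple //.
rewrite (nth_map (nseq_tuple n 0)) ?size_tuple //.
rewrite (dotpE (n := n)) ?size_tuple //; apply: eq_bigr => c _.
by rewrite !mxE (tnth_nth (nseq_tuple n 0)) (tnth_nth 0).
Qed.

Fixpoint all_zero (l : seq R) : Prop :=
  if l is f :: l' then f = 0 /\ all_zero l' else True.

Lemma all_zeroP n l : size l = n -> all_zero l <-> l = nseq n 0.
Proof.
move=> <-; elim: l => //= f l IHl.
by split=> [[-> /IHl {1}->//]|/(congr1 (fun s => (head 0 s, behead s)))/= [-> /IHl]].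
Qed.

Lemma mul_rows_eq0 p n (r : p.-tuple (n.-tuple R)) l : size l = n ->
  mx_of_rows r *m colv n l = 0 <-> all_zero (dots (rows_of r) l).
Proof.
have sz := size_dots r l; move=> ln; rewrite mul_rows // -colv0.
split=> [E|/(all_zeroP sz)->//]; apply/(all_zeroP sz).
by apply: colv_inj E; rewrite // size_nseq.
Qed.

(** On explicit matrices both hypotheses compute to systems of scalar equations. *)
Lemma exact_at_rows p n q (r : p.-tuple (n.-tuple R)) (r' : n.-tuple (q.-tuple R)) :
    (forall w, size w = q -> all_zero (dots (rows_of r) (dots (rows_of r') w))) ->
    (forall v, size v = n -> all_zero (dots (rows_of r) v) ->
      exists2 w, size w = q & v = dots (rows_of r') w) ->
  exact_at (mx_of_rows r) (mx_of_rows r').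
Proof.
move=> cplx ex v; split=> [|[w ->]].
  have [l ln ->] := colvP v => /(mul_rows_eq0 _ ln)/(ex _ ln)[w wq ->].
  by exists (colv q w); rewrite mul_rows.
have [l lq ->] := colvP w; rewrite (mul_rows _ lq).
by apply/mul_rows_eq0; [rewrite size_dots | apply: cplx].
Qed.

Lemma injective_rows p n (r : p.-tuple (n.-tuple R)) :
  (forall v, size v = n -> all_zero (dots (rows_of r) v) -> all_zero v) ->
  forall v : 'cV_n, mx_of_rows r *m v = 0 -> v = 0.
Proof.
move=> inj v; have [l ln ->] := colvP v.
by move=> /(mul_rows_eq0 _ ln)/(inj _ ln)/(all_zeroP ln)->; rewrite colv0.
Qed.

Lemma irrelevant_homog d (f : R) : (0 < d)%N -> f \is d.-homog -> irrelevant_ideal f.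
Proof.
move=> d_gt0 hf; have idI := ideal_gen_is_ideal (fun g : R => exists i, g = 'X_i).
rewrite (mpolyE f) big_seq; apply: (ideal_sum idI) => e /(dhomog_mf hf) /= e_d.
have [i e_i] : exists i, (0 < e i)%N.
  apply/existsP; apply: contraLR d_gt0 => /existsPn e0.
  by rewrite -e_d mdegE big1 // => i _; apply/eqP; rewrite -leqn0 leqNgt.
have -> : e = (e - U_(i) + U_(i))%MM.
  by rewrite submK //; apply/mnm_lepP => l; rewrite mnm1E; case: eqP => // <-.
rewrite mpolyXD scalerAl; apply: (idealM idI).
by apply: mem_ideal_gen; exists i.
Qed.

(** An entry (i, j) of degree d_j - e_i is what homogeneity of degree zero asks for,
and this degree being positive puts it in the irrelevant ideal. *)
Lemma entries_graded_minimal p n (e : p.-tuple nat) (d : n.-tuple nat) (phi : 'M[R]_(p, n)) :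
    (forall i j, phi i j = 0 \/
      (tnth e i < tnth d j)%N /\ phi i j \is (tnth d j - tnth e i).-homog) ->
  graded_map e d phi /\ minimal_map phi.
Proof.
move=> phiP; split=> [s v hv i|v i].
  have termP j : if (tnth e i <= s)%N then phi i j * v j 0 \is (s - tnth e i).-homog
                 else phi i j * v j 0 == 0.
    have := hv j; case: (phiP i j) => [->|[lt_ed hphi]].
      by move=> _; rewrite mul0r; case: ifP; rewrite ?rpred0.
    case: ifP => [le_d hvj|_ /eqP->].
      rewrite (leq_trans (ltnW lt_ed) le_d).
      have -> : (s - tnth e i = (tnth d j - tnth e i) + (s - tnth d j))%N by lia.
      exact: dhomogM.
    by rewrite mulr0; case: ifP; rewrite ?rpred0.
  rewrite mxE; case: ifP termP => _ termP; first by apply: rpred_sum => j _; apply: termP.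
  by apply/eqP; apply: big1 => j _; apply/eqP; apply: termP.
have idI := ideal_gen_is_ideal (fun g : R => exists i, g = 'X_i).
rewrite mxE; apply: (ideal_sum idI) => j _; apply: (ideal_mulr idI).
case: (phiP i j) => [->|[lt_ed]]; first exact: ideal0 idI.
by apply: irrelevant_homog; rewrite subn_gt0.
Qed.

Fixpoint row_graded (e : nat) (d : seq nat) (row : seq R) : Prop :=
  match d, row with
  | dj :: d', f :: row' =>
      (f = 0 \/ (e < dj)%N /\ f \is (dj - e).-homog) /\ row_graded e d' row'
  | _, _ => True
  end.

Fixpoint rows_graded (e d : seq nat) (r : seq (seq R)) : Prop :=
  match e, r with
  | ei :: e', row :: r' => row_graded ei d row /\ rows_graded e' d r'
  | _, _ => True
  end.

Lemma rows_graded_minimal p n (e : p.-tuple nat) (d : n.-tuple nat)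
    (r : p.-tuple (n.-tuple R)) : rows_graded e d (rows_of r) ->
  graded_map e d (mx_of_rows r) /\ minimal_map (mx_of_rows r).
Proof.
have rowP ei (ds : seq nat) row : row_graded ei ds row -> forall j,
    (j < size ds)%N -> (j < size row)%N -> nth 0 row j = 0 \/
    (ei < nth 0 ds j)%N /\ nth 0 row j \is (nth 0 ds j - ei)%N.-homog.
  by elim: ds row => [|dj ds IH] [|f row] //= [Pf /IH{}IH] [|j] //=; apply: IH.
have rowsP (es ds : seq nat) rs : rows_graded es ds rs -> forall i,
    (i < size es)%N -> (i < size rs)%N -> row_graded (nth 0 es i) ds (nth [::] rs i).
  by elim: es rs => [|ei es IH] [|row rs] //= [Pf /IH{}IH] [|i] //=; apply: IH.
move=> gr; apply: entries_graded_minimal => i j.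
have := rowsP _ _ _ gr i; rewrite !size_map !size_tuple => /(_ (ltn_ord i) (ltn_ord i)).
rewrite (nth_map (nseq_tuple n 0)) ?size_tuple // => /rowP/(_ j).
rewrite !size_tuple => /(_ (ltn_ord j) (ltn_ord j)).
by rewrite mxE !(tnth_nth 0%N) (tnth_nth 0) (tnth_nth (nseq_tuple n 0)).
Qed.

Definition row_ideal n (phi : 'M[R]_(1, n)) (f : R) : Prop :=
  exists v : 'cV_n, (phi *m v) 0 0 = f.

Lemma row_ideal_is_ideal n (phi : 'M[R]_(1, n)) : is_ideal (row_ideal phi).
Proof.
split; first by exists 0; rewrite mulmx0 mxE.
  by move=> _ _ [v <-] [w <-]; exists (v + w); rewrite mulmxDr mxE.
by move=> c _ [v <-]; exists (c *: v); rewrite -scalemxAr mxE.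
Qed.

Lemma mem_row_ideal n (row : n.-tuple R) f :
  f \in tval row -> row_ideal (mx_of_rows [tuple row]) f.
Proof.
move=> /tnthP[j ->]; exists (delta_mx j 0); rewrite -colE mxE mxE.
by rewrite (tnth_nth row).
Qed.

Lemma row_ideal_min n (row : n.-tuple R) (J : R -> Prop) : is_ideal J ->
  (forall f, f \in tval row -> J f) ->
  forall f, row_ideal (mx_of_rows [tuple row]) f -> J f.
Proof.
move=> idJ rowJ _ [v <-]; rewrite mxE; apply: (ideal_sum idJ) => j _.
apply: (ideal_mulr idJ); rewrite mxE (tnth_nth row); apply: rowJ.
exact: mem_tnth.
Qed.

End MatricesByRows.

(** * The three resolutions *)

Lemma homog_cast (k : fieldType) s t (f : {mpoly k[4]}) :
  f \is s.-homog -> s = t -> f \is t.-homog.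
Proof. by move=> hf <-. Qed.

Lemma homogX (k : fieldType) i : ('X_i : {mpoly k[4]}) \is 1.-homog.
Proof. by rewrite dhomogX /= mdeg1. Qed.

Lemma homogN (k : fieldType) s (f : {mpoly k[4]}) :
  f \is s.-homog -> - f \is s.-homog.
Proof. by rewrite dhomogN. Qed.

(** The degrees of the two summands are computed separately and may have different
forms, such as 1 * 2 and 1 + 1. *)
Lemma homogD (k : fieldType) s t (f g : {mpoly k[4]}) :
  f \is s.-homog -> g \is t.-homog -> t = s -> f + g \is s.-homog.
Proof. by move=> hf hg E; apply: dhomogD; rewrite -?E // E. Qed.

Ltac solve_homog :=
  match goal with
  | |- is_true ((- _) \is _) => apply: homogN; solve_homog
  | |- is_true ((_ + _) \is _) => apply: homogD; [solve_homog | solve_homog | by lia]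
  | |- is_true ((_ * _) \is _) => apply: dhomogM; solve_homog
  | |- is_true ((_ ^+ _) \is _) => apply: dhomogMn; solve_homog
  | |- is_true ('X_ _ \is _) => apply: homogX
  end.

Ltac graded_entries :=
  apply: rows_graded_minimal => /=; repeat split;
  match goal with
  | |- 0 = 0 \/ _ => by left
  | |- _ => right; split; [by lia | apply: homog_cast; [solve_homog | by lia]]
  end.

Ltac zero_entries := repeat split; rewrite ?exprS; ring.

Ltac entrywise := do ?[congr (_ :: _)]; rewrite ?exprS; ring.

(** The equation E is a row of the matrix product, including its zero terms. *)
Ltac from_row E := refine (etrans _ E); rewrite ?exprS; ring.

Section Resolutions.
Variables (k : fieldType) (a : nat).

Let reg := cubic_regular_mpoly k.

Lemma phi_graded_minimal_1 : (0 < a)%N ->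
  [/\ graded_map [tuple 0%N] [tuple 2; 2; 2; a + 1; a + 1; a + 1]%N
        (phi1_1 k a) /\ minimal_map (phi1_1 k a),
      graded_map [tuple 2; 2; 2; a + 1; a + 1; a + 1]%N
        [tuple 3; a + 2; 3; a + 2; a + 2; a + 2; a + 2; a + 2]%N
        (phi2_1 k a) /\ minimal_map (phi2_1 k a)
    & graded_map [tuple 3; a + 2; 3; a + 2; a + 2; a + 2; a + 2; a + 2]%N
        [tuple a + 3; a + 3; a + 3]%N (phi3_1 k a) /\ minimal_map (phi3_1 k a)].
Proof. by move=> a_gt0; split; graded_entries. Qed.

Lemma phi_graded_minimal_2 : (0 < a)%N ->
  [/\ graded_map [tuple 0%N] [tuple 2; 2; 2; a + 1; a + 1]%N (phi1_2 k a) /\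
        minimal_map (phi1_2 k a),
      graded_map [tuple 2; 2; 2; a + 1; a + 1]%N
        [tuple 3; 3; a + 2; a + 2; a + 2]%N (phi2_2 k a) /\
        minimal_map (phi2_2 k a)
    & graded_map [tuple 3; 3; a + 2; a + 2; a + 2]%N [tuple a + 4]%N
        (phi3_2 k a) /\ minimal_map (phi3_2 k a)].
Proof. by move=> a_gt0; split; graded_entries. Qed.

Lemma phi_graded_minimal_3 :
  [/\ graded_map [tuple 0%N] [tuple 2; 2; 2; a + 1]%N (phi1_3 k a) /\
        minimal_map (phi1_3 k a),
      graded_map [tuple 2; 2; 2; a + 1]%N [tuple 3; a + 3; 3; a + 3; a + 3]%N
        (phi2_3 k a) /\ minimal_map (phi2_3 k a)
    & graded_map [tuple 3; a + 3; 3; a + 3; a + 3]%N [tuple a + 4; a + 4]%N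
        (phi3_3 k a) /\ minimal_map (phi3_3 k a)].
Proof. by split; graded_entries. Qed.

Lemma phi_exact_3 :
  [/\ exact_at (phi1_3 k a) (phi2_3 k a), exact_at (phi2_3 k a) (phi3_3 k a)
    & forall v : 'cV_2, phi3_3 k a *m v = 0 -> v = 0].
Proof.
split.
- apply: exact_at_rows => [[|w1 [|w2 [|w3 [|w4 [|w5 [|]]]]]] //= _|].
    by zero_entries.
  case=> [|v1 [|v2 [|v3 [|v4 [|]]]]] //= _ [E _].
  have [|w1 [w2 [w3 [w4 [w5 [-> -> -> ->]]]]]] :=
    @kernel_phi1_3 _ _ _ _ _ reg a v1 v2 v3 v4.
    by from_row E.
  by exists [:: w1; w2; w3; w4; w5] => //=; entrywise.
- apply: exact_at_rows => [[|w1 [|w2 [|]]] //= _|].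
    by zero_entries.
  case=> [|v1 [|v2 [|v3 [|v4 [|v5 [|]]]]]] //= _ [E1 [E2 [E3 [E4 _]]]].
  have [||||w1 [w2 [-> -> -> -> ->]]] := @kernel_phi2_3 _ _ _ _ _ reg a v1 v2 v3 v4 v5.
  - by from_row E1.
  - by from_row E2.
  - by from_row E3.
  - by from_row E4.
  by exists [:: w1; w2] => //=; entrywise.
apply: injective_rows => -[|v1 [|v2 [|]]] //= _ [E1 [_ [E2 [_ [_ _]]]]].
by have [||-> ->] := @kernel_phi3_3 _ _ _ _ _ reg a v1 v2; [from_row E1 | from_row E2 |].
Qed.

Lemma phi_exact_1 :
  [/\ exact_at (phi1_1 k a) (phi2_1 k a), exact_at (phi2_1 k a) (phi3_1 k a)
    & forall v : 'cV_3, phi3_1 k a *m v = 0 -> v = 0].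
Proof.
split.
- apply: exact_at_rows.
    case=> [|w1 [|w2 [|w3 [|w4 [|w5 [|w6 [|w7 [|w8 [|]]]]]]]]] //= _.
    by zero_entries.
  case=> [|v1 [|v2 [|v3 [|v4 [|v5 [|v6 [|]]]]]]] //= _ [E _].
  have [|w1 [w2 [w3 [w4 [w5 [w6 [w7 [w8 [[-> -> ->] [-> -> ->]]]]]]]]]] :=
    @kernel_phi1_1 _ _ _ _ _ reg a v1 v2 v3 v4 v5 v6.
    by from_row E.
  by exists [:: w1; w2; w3; w4; w5; w6; w7; w8] => //=; entrywise.
- apply: exact_at_rows => [[|w1 [|w2 [|w3 [|]]]] //= _|].
    by zero_entries.
  case=> [|v1 [|v2 [|v3 [|v4 [|v5 [|v6 [|v7 [|v8 [|]]]]]]]]] //= _.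
  move=> [E1 [E2 [E3 [E4 [E5 [_ _]]]]]].
  have [|||||w1 [w2 [w3 [[-> -> -> ->] [-> -> -> ->]]]]] :=
    @kernel_phi2_1 _ _ _ _ _ reg a v1 v2 v3 v4 v5 v6 v7 v8.
  - by from_row E1.
  - by from_row E2.
  - by from_row E3.
  - by from_row E4.
  - by from_row E5.
  by exists [:: w1; w2; w3] => //=; entrywise.
apply: injective_rows => -[|v1 [|v2 [|v3 [|]]]] //= _ [E1 [_ [E3 [_ [_ [E6 [_ [_ _]]]]]]]].
have [|||-> -> ->//] := @kernel_phi3_1 _ _ _ _ _ reg a v1 v2 v3.
- by from_row E1.
- by from_row E3.
- by from_row E6.
Qed.

Lemma phi_exact_2 :
  [/\ exact_at (phi1_2 k a) (phi2_2 k a), exact_at (phi2_2 k a) (phi3_2 k a)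
    & forall v : 'cV_1, phi3_2 k a *m v = 0 -> v = 0].
Proof.
split.
- apply: exact_at_rows => [[|w1 [|w2 [|w3 [|w4 [|w5 [|]]]]]] //= _|].
    by zero_entries.
  case=> [|v1 [|v2 [|v3 [|v4 [|v5 [|]]]]]] //= _ [E _].
  have [|w1 [w2 [w3 [w4 [w5 [-> -> -> -> ->]]]]]] :=
    @kernel_phi1_2 _ _ _ _ _ reg a v1 v2 v3 v4 v5.
    by from_row E.
  by exists [:: w1; w2; w3; w4; w5] => //=; entrywise.
- apply: exact_at_rows => [[|w1 [|]] //= _|].
    by zero_entries.
  case=> [|v1 [|v2 [|v3 [|v4 [|v5 [|]]]]]] //= _ [_ [E2 [E3 [E4 [E5 _]]]]].
  have [||||w [-> -> -> -> ->]] := @kernel_phi2_2 _ _ _ _ _ reg a v1 v2 v3 v4 v5.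
  - by from_row E2.
  - by from_row E3.
  - by from_row E4.
  - by from_row E5.
  by exists [:: w] => //=; entrywise.
apply: injective_rows => -[|v1 [|]] //= _ [E1 [_ [_ [_ [_ _]]]]].
by rewrite (@kernel_phi3_2 _ _ _ _ _ reg a v1) //; from_row E1.
Qed.

End Resolutions.

Lemma minimal_resolution_intro (k : fieldType) n1 n2 n3 (J : {mpoly k[4]} -> Prop)
    (d1 : n1.-tuple nat) (d2 : n2.-tuple nat) (d3 : n3.-tuple nat)
    (phi1 : 'M[{mpoly k[4]}]_(1, n1)) (phi2 : 'M_(n1, n2)) (phi3 : 'M_(n2, n3)) :
    (forall f, J f <-> row_ideal phi1 f) ->
    [/\ graded_map [tuple 0%N] d1 phi1 /\ minimal_map phi1,
        graded_map d1 d2 phi2 /\ minimal_map phi2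
      & graded_map d2 d3 phi3 /\ minimal_map phi3] ->
    [/\ exact_at phi1 phi2, exact_at phi2 phi3
      & forall v : 'cV_n3, phi3 *m v = 0 -> v = 0] ->
  minimal_graded_free_resolution J d1 d2 d3 phi1 phi2 phi3.
Proof. by move=> JE [[g1 m1] [g2 m2] [g3 m3]] [e1 e2 e3]; split; split. Qed.

(** The quadrics make monomials of equal bidegree congruent, and the other entries
absorb the monomials of cubic degree at least 3a+b. *)
Lemma tangent_row (k : fieldType) (a b d : nat) (m : 'I_4 -> nat) n
    (row : n.-tuple {mpoly k[4]}) :
    (0 < b)%N -> (0 < d)%N -> coprime (3 * a + b) d ->
    (forall i : 'I_4, m i = (3 * a + b + i * d)%N) ->
    {subset [:: 'X_O1 ^+ 2 - 'X_O0 * 'X_O2; 'X_O1 * 'X_O2 - 'X_O0 * 'X_O3;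
                'X_O2 ^+ 2 - 'X_O1 * 'X_O3; 'X_O3 ^+ a.+1] <= tval row} ->
    ((b <= 2)%N -> 'X_O2 * 'X_O3 ^+ a \in tval row) ->
    ((b <= 1)%N -> 'X_O1 * 'X_O3 ^+ a \in tval row) ->
    (forall f, f \in tval row -> tangent_ideal m f) ->
  forall f, tangent_ideal m f <-> row_ideal (mx_of_rows [tuple row]) f.
Proof.
move=> b_gt0 d_gt0 coMd mE row_q row_x2 row_x1 rowT f.
split; last exact: (row_ideal_min (tangent_ideal_is_ideal _ _) rowT).
have idJ := row_ideal_is_ideal (mx_of_rows [tuple row]).
have [J1 J2 J3 Jy] : [/\ row_ideal (mx_of_rows [tuple row]) ('X_O1 ^+ 2 - 'X_O0 * 'X_O2),
    row_ideal (mx_of_rows [tuple row]) ('X_O1 * 'X_O2 - 'X_O0 * 'X_O3),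
    row_ideal (mx_of_rows [tuple row]) ('X_O2 ^+ 2 - 'X_O1 * 'X_O3)
    & row_ideal (mx_of_rows [tuple row]) ('X_O3 ^+ a.+1)].
  split; apply: mem_row_ideal; apply: row_q.
  - exact: mem_head.
  - by rewrite in_cons mem_head orbT.
  - by rewrite 2!in_cons mem_head !orbT.
  - by rewrite 3!in_cons mem_head !orbT.
apply: (tangent_sub mE d_gt0 coMd idJ J1 J2 J3) => e le_e.
apply: (cubic_degree_large idJ J1 J2 J3 b_gt0 Jy _ _ le_e).
  by move/row_x2; apply: mem_row_ideal.
by move/row_x1; apply: mem_row_ideal.
Qed.

Theorem corollary3p2 (k : fieldType) (a d b : nat) (m : 'I_4 -> nat)
    (ha : (1 <= a)%N) (hd : (1 <= d)%N) (hb : b = 1%N \/ b = 2%N \/ b = 3%N)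
    (hm : forall i : 'I_4, m i = (3 * a + b + i * d)%N)
    (hgcd : \big[gcdn/0%N]_(i < 4) m i = 1%N) :
  @presents_gr k m (tangent_ideal m) /\
  (b = 1%N ->
    minimal_graded_free_resolution (@tangent_ideal k m)
      [tuple 2; 2; 2; a + 1; a + 1; a + 1]%N
      [tuple 3; a + 2; 3; a + 2; a + 2; a + 2; a + 2; a + 2]%N
      [tuple a + 3; a + 3; a + 3]%N
      (phi1_1 k a) (phi2_1 k a) (phi3_1 k a)) /\
  (b = 2%N ->
    minimal_graded_free_resolution (@tangent_ideal k m)
      [tuple 2; 2; 2; a + 1; a + 1]%N
      [tuple 3; 3; a + 2; a + 2; a + 2]%N
      [tuple a + 4]%N
      (phi1_2 k a) (phi2_2 k a) (phi3_2 k a)) /\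
  (b = 3%N ->
    minimal_graded_free_resolution (@tangent_ideal k m)
      [tuple 2; 2; 2; a + 1]%N
      [tuple 3; a + 3; 3; a + 3; a + 3]%N
      [tuple a + 4; a + 4]%N
      (phi1_3 k a) (phi2_3 k a) (phi3_3 k a)).
Proof.
set M := (3 * a + b)%N in hm.
have m_gt0 i : (0 < m i)%N by rewrite hm /M; lia.
have coMd : coprime M d.
  rewrite /coprime -dvdn1 -hgcd; apply/dvdn_biggcdP => i _.
  by rewrite hm dvdn_add ?dvdn_gcdl ?dvdn_mull ?dvdn_gcdr.
have [T1 T2 T3] := tangent_quadrics k hm.
have T := @tangent_mono4 k m M d hm.
have presents := tangent_presents_gr k m_gt0.
split=> //; split; [|split] => b_eq; subst b.
- apply: minimal_resolution_intro (phi_graded_minimal_1 k ha) (phi_exact_1 k a).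
  (* With M = 3a+1, the forms x1 y^a, x2 y^a, y^(a+1) have the weights of
     x0^(a+1+d), x0^(a+d) x1, x0^(a+d) x2. *)
  have Tx1 : tangent_ideal m ('X_O1 * 'X_O3 ^+ a : {mpoly k[4]}).
    have := T 1 0 a (a + 1 + d) 0 0; rewrite expr1 expr0 mulr1.
    by apply; rewrite /M; [lia | ring].
  have Tx2 : tangent_ideal m ('X_O2 * 'X_O3 ^+ a : {mpoly k[4]}).
    have := T 0 1 a (a + d) 1 0; rewrite expr1 expr0 mul1r.
    by apply; rewrite /M; [lia | ring].
  have Ty : tangent_ideal m ('X_O3 ^+ a.+1 : {mpoly k[4]}).
    have := T 0 0 a.+1 (a + d) 0 1; rewrite !expr0 !mul1r.
    by apply; rewrite /M; [lia | ring].
  apply: (tangent_row _ hd coMd hm) => //.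
  - by move=> f; rewrite !inE => /or4P[] ->; rewrite ?orbT.
  - by rewrite !inE eqxx ?orbT.
  - by rewrite !inE eqxx ?orbT.
  by move=> f; rewrite !inE; do 5?[case/predU1P=> [->//|]]; move/eqP->.
- apply: minimal_resolution_intro (phi_graded_minimal_2 k ha) (phi_exact_2 k a).
  (* With M = 3a+2, the forms x2 y^a, y^(a+1) have the weights of x0^(a+1+d),
     x0^(a+d) x1. *)
  have Tx2 : tangent_ideal m ('X_O2 * 'X_O3 ^+ a : {mpoly k[4]}).
    have := T 0 1 a (a + 1 + d) 0 0; rewrite expr1 expr0 mul1r.
    by apply; rewrite /M; [lia | ring].
  have Ty : tangent_ideal m ('X_O3 ^+ a.+1 : {mpoly k[4]}).
    have := T 0 0 a.+1 (a + d) 1 0; rewrite !expr0 !mul1r.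
    by apply; rewrite /M; [lia | ring].
  apply: (tangent_row _ hd coMd hm) => //.
  - by move=> f; rewrite !inE => /or4P[] ->; rewrite ?orbT.
  - by rewrite !inE eqxx ?orbT.
  by move=> f; rewrite !inE; do 4?[case/predU1P=> [->//|]]; move/eqP->.
- apply: minimal_resolution_intro (phi_graded_minimal_3 k a) (phi_exact_3 k a).
  (* With M = 3a+3, the form y^(a+1) has the weight of x0^(a+1+d). *)
  have Ty : tangent_ideal m ('X_O3 ^+ a.+1 : {mpoly k[4]}).
    have := T 0 0 a.+1 (a + 1 + d) 0 0; rewrite !expr0 !mul1r.
    by apply; rewrite /M; [lia | ring].
  apply: (tangent_row _ hd coMd hm) => //.
  by move=> f; rewrite !inE; do 3?[case/predU1P=> [->//|]]; move/eqP->.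
Qed.
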